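(* Let $3/4 \leq \alpha \leq 1$ and let $$\mathcal{O}_{\alpha} = \Big\{ x \in [0,1] : \sup_{0<t<1} |w_N(x,t)| \geq N^{\alpha} \text{ for infinitely many } N \in \mathbb{N} \Big\}.$$ Then the Hausdorff dimension of $\mathcal{O}_{\alpha}$ is $\dim(\mathcal{O}_{\alpha}) = 4(1-\alpha)$.
   Context: For $N \in \mathbb{N}$ and real $x,t$, $w_N(x,t) = \sum_{n=1}^{N} e^{2\pi i (nx + n^2 t)}$. The torus $\mathbb{T}$ is identified with $[0,1]$. The Hausdorff dimension of a Borel set $\mathcal{S}$ is $\dim(\mathcal{S}) = \inf\{ s > 0 : \mathcal{H}^s(\mathcal{S}) = 0 \}$, where $\mathcal{H}^s$ is $s$-dimensional Hausdorff measure. *)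

(* Defs.v *)
From HB Require Import structures.
From mathcomp Require Import all_boot all_order all_algebra.
From mathcomp Require Import all_classical all_reals all_analysis.
From mathcomp Require Import complex.

Set Implicit Arguments.
Unset Strict Implicit.
Unset Printing Implicit Defensive.

Import Order.TTheory GRing.Theory Num.Theory.
Import numFieldNormedType.Exports.

Local Open Scope classical_set_scope.
Local Open Scope ring_scope.

Section HausdorffDimension.
Context {R : realType} {V : normedModType R}.
Implicit Types (A S : set V) (s d : R).
Local Open Scope ereal_scope.

(* The maximum with 0 only affects the empty set, whose diameter is 0. *)
Definition diameter A : \bar R :=
  maxe 0 (ereal_sup [set (`|x - y|%R)%:E | x in A & y in A]).

(* diam(A)^s, with the convention that the empty set contributes 0 even when
   s = 0; covers may thus be indexed by nat even when they are finite. *)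
Definition hausdorff_gauge s A : \bar R :=
  if A == set0 then 0 else (diameter A) `^ s.

Definition hausdorff_premeasure s d S : \bar R :=
  ereal_inf [set \sum_(0 <= k <oo) hausdorff_gauge s (F k) |
    F in [set F : (set V)^nat |
      S `<=` \bigcup_k F k /\ forall k, diameter (F k) <= d%:E]].

(* The premeasure is nonincreasing in d, so this supremum is its limit as d
   tends to 0. It is an outer measure, defined on every subset of V. *)
Definition hausdorff_measure s S : \bar R :=
  ereal_sup [set hausdorff_premeasure s d S | d in [set d : R | (0 < d)%R]].

Definition hausdorff_dim S : \bar R :=
  ereal_inf [set s%:E | s in [set s : R | (0 < s)%R /\ hausdorff_measure s S = 0]].

End HausdorffDimension.

Section WeylSums.
Context {R : realType}.
Implicit Types (x t theta alpha : R) (N : nat).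

(* e^{i theta} *)
Definition expi theta : R[i] := Complex (cos theta) (sin theta).

Definition weyl_sum N x t : R[i] :=
  \sum_(1 <= n < N.+1) expi (2 * pi * (n%:R * x + n%:R ^+ 2 * t)).

Definition weyl_sup N x : \bar R :=
  ereal_sup [set (ComplexField.Normc.normc (weyl_sum N x t))%:E |
    t in `]0, 1[%classic].

Definition large_weyl_set alpha : set R :=
  [set x | `[0, 1]%classic x /\
    infinite_set [set N : nat | ((N%:R `^ alpha)%:E <= weyl_sup N x)%E]].

End WeylSums.

(* Main.v *)
Require Import Defs.
From mathcomp Require Import all_boot all_order all_algebra.
From mathcomp Require Import all_classical all_reals all_analysis.
From mathcomp Require Import complex.
From mathcomp Require Import ring lra zify.

Import Order.TTheory GRing.Theory Num.Theory.
Import numFieldNormedType.Exports.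

Set Implicit Arguments.
Unset Strict Implicit.
Unset Printing Implicit Defensive.

Local Open Scope ring_scope.

Local Notation cabs := ComplexField.Normc.normc.

(** The value of sup_t |w_N(x, t)| is governed by how well x is approximated by
    rationals: it exceeds N^alpha essentially when some fraction b/q with
    q <= N^(2 - 2 alpha) lies within q^-1 N^(1 - 2 alpha) of x.  The limsup set
    of such neighbourhoods has dimension 4(1 - alpha) by counting.

    Upper bound.  Squaring w_N (sqr_sum_unimodular_le) produces, for each shift
    h, a geometric sum with ratio e(2ht).  Let a/q approximate 2t.  The shifts
    that are not multiples of q contribute only about (N + K) log K, where K is
    the level in Dirichlet's theorem.  On the multiples h = qj the sum over j
    has a phase whose increments stay close to y = qx + qa/2 modulo 1, so
    summation by parts (slow_phase_sum_le) bounds it by the inverse distance of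
    y to the integers.  The resulting inequality (weyl_inequality) thus controls
    x as well as t, and with K close to N^(2 alpha) it forces the rational
    approximation of x (large_weyl_sum_near_rational), up to factors N^eps.
    Only dyadic scales of N matter for covering, and at scale X = 2^k the cost
    of the neighbourhoods in the s-dimensional gauge is X^(4(1 - alpha) - s) up
    to X^eps, which is summable for s > 4(1 - alpha) (large_weyl_set_null).

    Lower bound.  For odd q the complete Gauss sum with denominator q has
    modulus sqrt q for every linear coefficient b, so w_N(x, 1/q) has size
    N / sqrt q as soon as |x - b/q| is at most a small multiple of 1/N
    (weyl_sum_near_rational_ge).  With N close to q^tau this is at least
    N^alpha provided 2 tau (1 - alpha) > 1.  Hence every x in [0, 1] with
    |x - b/q| <= q^-tau for infinitely many odd q belongs to the set, and a
    Jarnik-Besicovitch argument remains: no sequence of sets with small sum of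
    r_i^s covers those x when s < 2/tau (exists_uncovered_approximable).  The
    uncovered point is found without a measure, as the intersection of nested
    intervals chosen so that the sets meeting the current interval of radius
    rho always satisfy sum r_i^s <= rho^s / 12.  Then r_i < rho for each of them,
    so in the limit no set of the cover can contain the point.  The choice of
    the next interval (light_child_exists) is an averaging over many separated
    fractions with odd denominators (card_farey_ge, farey_separated). *)

(** * Phases and their distance to 1 *)

Section Phase.
Context {R : realType}.
Implicit Types (x y z t : R) (u v : R[i]) (n m q : nat).

Definition phase x : R[i] := expi (2 * pi * x).


Lemma cabs_ge0 u : 0 <= cabs u.
Proof. by case: u => a b; exact: sqrtr_ge0. Qed.

Lemma cabsD u v : cabs (u + v) <= cabs u + cabs v.
Proof. exact: le_normcD. Qed.

Lemma cabsN u : cabs (- u) = cabs u.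
Proof. exact: normcN. Qed.

Lemma cabsB u v : cabs (u - v) <= cabs u + cabs v.
Proof. by rewrite (le_trans (cabsD _ _))// cabsN. Qed.

Lemma cabs_distC u v : cabs (u - v) = cabs (v - u).
Proof. by rewrite -cabsN opprB. Qed.

Lemma cabs_sum (I : Type) (r : seq I) (P : pred I) (F : I -> R[i]) :
  cabs (\sum_(i <- r | P i) F i) <= \sum_(i <- r | P i) cabs (F i).
Proof.
elim/big_ind2 : _ => //; first by rewrite ComplexField.Normc.normc0.
by move=> a a' b b' ha hb; rewrite (le_trans (cabsD _ _))// lerD.
Qed.

Lemma cabsM u v : cabs (u * v) = cabs u * cabs v.
Proof. exact: ComplexField.Normc.normcM. Qed.

Lemma cabs_nat n : cabs (n%:R : R[i]) = n%:R.
Proof.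
have -> : (n%:R : R[i]) = (n%:R : R)%:C%C by rewrite rmorph_nat.
by rewrite /= expr0n /= addr0 sqrtr_sqr ger0_norm.
Qed.

Lemma phaseD x y : phase (x + y) = phase x * phase y.
Proof.
by rewrite /phase mulrDr /expi cosD sinD; congr (Complex _ _); rewrite addrC.
Qed.

Lemma phase0 : phase 0 = 1.
Proof. by rewrite /phase mulr0 /expi cos0 sin0. Qed.

Lemma phase1 : phase 1 = 1.
Proof. by rewrite /phase mulr1 /expi mulr_natl cos2pi sin2pi. Qed.

Lemma phase_nat n : phase n%:R = 1.
Proof.
by elim: n => [|n IH]; rewrite ?phase0// -natr1 phaseD IH phase1 mul1r.
Qed.

Lemma phaseN x : phase (- x) = (phase x)^*%C.
Proof. by rewrite /phase mulrN /expi cosN sinN. Qed.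

Lemma phase_int (b : int) : phase b%:~R = 1.
Proof.
case: b => n; first exact: phase_nat.
by rewrite NegzE mulrNz phaseN -[_%:~R]/(n.+1%:R) phase_nat conjc1.
Qed.

Lemma phaseDint x (b : int) : phase (x + b%:~R) = phase x.
Proof. by rewrite phaseD phase_int mulr1. Qed.

Lemma phaseDnat x n : phase (x + n%:R) = phase x.
Proof. by rewrite phaseD phase_nat mulr1. Qed.

Lemma cabs_phase x : cabs (phase x) = 1.
Proof. by rewrite /phase /= cos2Dsin2 sqrtr1. Qed.

Lemma phaseB x y : phase x * (phase y)^*%C = phase (x - y).
Proof. by rewrite phaseD phaseN. Qed.

Lemma cabs_phase_sub1 z : cabs (phase z - 1) = 2 * `|sin (pi * z)|.
Proof.
have -> : cabs (phase z - 1) =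
    Num.sqrt ((cos (2 * pi * z) - 1) ^+ 2 + sin (2 * pi * z) ^+ 2).
  by rewrite /= oppr0 addr0.
rewrite sin2cos2 -mulrA mulr_natl cos_mulr2n.
have -> : (cos (pi * z) ^+ 2 *+ 2 - 1 - 1) ^+ 2 +
   (1 - (cos (pi * z) ^+ 2 *+ 2 - 1) ^+ 2) = (2 * sin (pi * z)) ^+ 2.
  by rewrite exprMn sin2cos2; ring.
by rewrite sqrtr_sqr normrM ger0_norm.
Qed.

Lemma norm_sin_le (x : R) : `|sin x| <= `|x|.
Proof.
wlog x0 : x / 0 <= x => [h|].
  have [/h//|/ltW x0] := leP 0 x.
  by rewrite -[x]opprK sinN 2!normrN; apply: h; rewrite oppr_ge0.
have [c _] : exists2 c, c \in `[0, x] & sin x - sin 0 = cos c * (x - 0).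
  apply: MVT_segment => //; exact/continuous_subspaceT/continuous_sin.
by rewrite sin0 !subr0 => ->; rewrite normrM ler_piMl// cos_max.
Qed.

Lemma phase_sub1_le z : cabs (phase z - 1) <= 8 * `|z|.
Proof.
rewrite cabs_phase_sub1; have := norm_sin_le (pi * z).
rewrite normrM gtr0_norm ?pi_gt0// => h.
have p4 : pi <= 4 :> R by have := @pihalf_lt2 R; lra.
have := normr_ge0 z; nra.
Qed.

(** Writing sin y = 2 sin (y/2) cos (y/2) keeps all cosines at angles at most
    pi / 4, where they are at least 1/2. *)
Lemma sin_ge_eighth (y : R) : 0 <= y <= pi / 2 -> y / 8 <= sin y.
Proof.
move=> /andP[y0 yp].
have cge : forall c, 0 <= c <= y / 2 -> 1 / 2 <= cos c :> R.
  move=> c /andP[c0 cy].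
  have p0 := @pi_gt0 R.
  have p4 : pi <= 4 :> R by have := @pihalf_lt2 R; lra.
  have c4 : cos (pi / 4) ^+ 2 = 1 / 2 :> R.
    have := @cos_mulr2n R (pi / 4).
    have -> : pi / 4 *+ 2 = pi / 2 :> R by field.
    by rewrite cos_pihalf; lra.
  have c40 : 0 <= cos (pi / 4) :> R by apply: cos_ge0_pihalf; apply/andP; split; lra.
  have : cos (pi / 4) <= cos c.
    rewrite leNgt ltr_cos ?in_itv /= -?leNgt; first lra.
      by apply/andP; split; lra.
    by apply/andP; split; lra.
  apply: le_trans; rewrite -(@ler_pXn2r _ 2) ?nnegrE //; lra.
have [c] : exists2 c, c \in `[0, y / 2] & sin (y / 2) - sin 0 = cos c * (y / 2 - 0).
  apply: MVT_segment; first lra.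
  exact/continuous_subspaceT/continuous_sin.
rewrite in_itv /= => hc; rewrite sin0 !subr0 => hs.
have := sin_mulr2n (y / 2).
have -> : y / 2 *+ 2 = y by field.
rewrite hs => ->.
have h1 := cge c hc.
have h2 : 1 / 2 <= cos (y / 2) by apply: cge; apply/andP; split; lra.
have h3 : 1 / 4 <= cos (y / 2) * cos c by nra.
have h4 : 0 <= (cos (y / 2) * cos c - 1 / 4) * y by apply: mulr_ge0 => //; lra.
lra.
Qed.

(** The chord |e(z) - 1| replaces the distance from z to the nearest integer in
    all that follows; this bound turns a small chord into an approximation. *)
Lemma phase_sub1_ge z : exists b : int, `|z - b%:~R| <= 2 * cabs (phase z - 1).
Proof.
pose b := Num.floor (z + 1 / 2); exists b.
have /andP[bl bu] : b%:~R <= z + 1 / 2 < (b + 1)%:~R by exact: floor_itv.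
rewrite rmorphD /= in bu.
set y := z - b%:~R.
have -> : phase z = phase y by rewrite -[z](subrK b%:~R) phaseDint.
rewrite cabs_phase_sub1.
have -> : `|sin (pi * y)| = `|sin (pi * `|y|)|.
  have [//|_] := ger0P y.
  by rewrite mulrN sinN normrN.
have p2 := @pi_ge2 R.
have yh : `|y| <= 1 / 2 by rewrite ler_norml; apply/andP; split; rewrite /y; lra.
have y0 := normr_ge0 y.
have h : pi * `|y| / 8 <= sin (pi * `|y|).
  by apply: sin_ge_eighth; apply/andP; split; nra.
have := ler_norm (sin (pi * `|y|)).
nra.
Qed.

(** Multiplying by e(x) - 1 telescopes the sum. *)
Lemma geom_phase_le x c n :
  cabs (\sum_(m < n) phase (c + m%:R * x)) * cabs (phase x - 1) <= 2.
Proof.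
rewrite -cabsM mulr_suml.
rewrite (eq_bigr (fun m : 'I_n => phase (c + m.+1%:R * x) - phase (c + m%:R * x))).
  rewrite -(big_mkord xpredT (fun m => phase (c + m.+1%:R * x) - phase (c + m%:R * x))).
  rewrite telescope_sumr//.
  by rewrite (le_trans (cabsB _ _))// !cabs_phase.
move=> m _; rewrite mulrBr mulr1 -phaseD -natr1; congr (phase _ - _); ring.
Qed.

End Phase.

(** * Rational approximation, harmonic sums and reindexing *)

Section Dirichlet.
Context {R : realType}.
Implicit Types (z : R) (K q a : nat).

(** Two of the K + 1 fractional parts of k z fall into the same cell of length
    1/K; since z >= 0 the difference of the integer parts is a natural number. *)
Lemma dirichlet_pigeonhole z K : 0 <= z -> (0 < K)%N ->
  exists q a, [/\ (0 < q <= K)%N & `|q%:R * z - a%:R| <= K%:R^-1].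
Proof.
move=> z0 K0; have KR : 0 < K%:R :> R by rewrite ltr0n.
pose fl k := Num.truncn (k%:R * z : R).
have flP k : (fl k)%:R <= k%:R * z < (fl k).+1%:R.
  by apply: truncn_itv; rewrite mulr_ge0.
pose g k := Num.truncn (K%:R * (k%:R * z - (fl k)%:R) : R).
have gP k : (g k)%:R <= K%:R * (k%:R * z - (fl k)%:R) < (g k).+1%:R.
  by apply: truncn_itv; rewrite mulr_ge0// subr_ge0; case/andP: (flP k).
have gK k : (g k < K)%N.
  rewrite truncn_lt_nat; last first.
    by rewrite mulr_ge0// subr_ge0; case/andP: (flP k).
  rewrite -[ltRHS]mulr1 ltr_pM2l//.
  by have := flP k; rewrite -natr1; lra.
pose f (k : 'I_K.+1) := Ordinal (gK k).
have : ~~ injectiveb f.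
  by apply/injectiveP => /leq_card; rewrite !card_ord ltnn.
move=> /injectivePn[i [j ij /(congr1 val)/= gij]].
wlog lt : i j ij gij / (i < j)%N.
  move=> h; case: (ltngtP i j) => [/h||/val_inj/eqP]; last by rewrite (negPf ij).
    exact.
  by move=> /h; apply => //; rewrite eq_sym.
exists (j - i)%N, (fl j - fl i)%N; split.
  have := ltn_ord j; lia.
have fij : (fl i <= fl j)%N.
  apply: le_truncn; apply: ler_wpM2r => //; rewrite ler_nat; exact: ltnW.
rewrite !natrB//; last exact: ltnW.
rewrite -[leRHS]mul1r ler_pdivlMr// -[K%:R]gtr0_norm// -normrM.
have := gP i; have := gP j; rewrite gij -!natr1 => h1 h2.
by rewrite ler_norml; apply/andP; split; lra.
Qed.

Lemma dirichlet_coprime z K : 0 <= z -> (0 < K)%N ->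
  exists q a, [/\ (0 < q <= K)%N, coprime a q & `|q%:R * z - a%:R| <= K%:R^-1].
Proof.
move=> z0 K0; have [q [a [/andP[q0 qK] h]]] := dirichlet_pigeonhole z0 K0.
have d0 : (0 < gcdn a q)%N by rewrite gcdn_gt0 q0 orbT.
exists (q %/ gcdn a q)%N, (a %/ gcdn a q)%N; split.
- rewrite divn_gt0// dvdn_leq ?dvdn_gcdr//=.
  exact: leq_trans (leq_div _ _) qK.
- by rewrite /coprime -(eqn_pmul2r d0) mul1n muln_gcdl !divnK ?dvdn_gcdl ?dvdn_gcdr.
- apply: le_trans h.
  have qE := esym (divnK (dvdn_gcdr a q)).
  have aE := esym (divnK (dvdn_gcdl a q)).
  rewrite [X in _ <= `|X%:R * z - _|]qE [X in _ <= `|_ - X%:R|]aE !natrM.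
  rewrite mulrAC -mulrBl normrM ler_peMr// ger0_norm// ler1n//.
Qed.

End Dirichlet.

Section Harmonic.
Context {R : realType}.

Lemma harmonic_le_ln n : \sum_(1 <= r < n.+1) (r%:R^-1 : R) <= 1 + ln n%:R.
Proof.
case: n => [|n]; first by rewrite big_nil ln0// addr0.
elim: n => [|n IH]; first by rewrite big_nat1 invr1 ln1 addr0.
rewrite big_nat_recr//=.
have n1 : 0 < n.+1%:R :> R by rewrite ltr0n.
have n2 : 0 < n.+2%:R :> R by rewrite ltr0n.
have := @le_ln1Dx R (- n.+2%:R^-1).
have -> : 1 + - n.+2%:R^-1 = n.+1%:R / n.+2%:R :> R.
  have -> : n.+1%:R = n.+2%:R - 1 :> R by rewrite -[n.+2%:R]natr1 addrK.
  by rewrite mulrBl divff ?gt_eqF// mul1r.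
rewrite ln_div ?posrE// => h.
have : ln n.+1%:R - ln n.+2%:R <= - (n.+2%:R^-1) :> R.
  by apply: h; rewrite ltrN2 invf_lt1// ltr1n.
move=> hln; apply: le_trans (lerD IH (lexx _)) _; rewrite -addrA lerD2l.
by rewrite -lerBrDr [leRHS]addrC -lerBlDr.
Qed.

Lemma sum_inv_dist_le q :
  \sum_(r < q) (r%:R^-1 + (q - r)%:R^-1 : R) <= 2 * (1 + ln q%:R).
Proof.
rewrite big_split /= mulr2n mulrDl mul1r; apply: lerD.
  apply: le_trans (harmonic_le_ln q).
  rewrite -(big_mkord xpredT (fun r => r%:R^-1 : R)).
  case: q => [|q]; first by rewrite !big_nil.
  by rewrite big_ltn// invr0 add0r [leRHS]big_nat_recr//= lerDl invr_ge0.
apply: le_trans (harmonic_le_ln q).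
rewrite -(big_mkord xpredT (fun r => (q - r)%:R^-1 : R)) big_nat_rev /=.
rewrite big_add1 /= !big_mkord; apply: ler_sum => i _.
by rewrite add0n subKn.
Qed.

End Harmonic.

Section Reindex.

Lemma sum_triangle (V : nmodType) N (F : nat -> nat -> V) :
  \sum_(n < N) \sum_(m < n) F n m =
  \sum_(m < N) \sum_(h < N - m | (0 < h)%N) F (m + h)%N m.
Proof.
elim: N => [|N IH]; first by rewrite !big_ord0.
rewrite big_ord_recr /= IH [RHS]big_ord_recr /=.
rewrite [X in _ = _ + X]big1 ?addr0; last first.
  by move=> h; have := ltn_ord h; lia.
rewrite -big_split /=; apply: eq_bigr => m _.
have mN : (m <= N)%N by apply: ltnW.
rewrite subSn// [RHS]big_mkcond big_ord_recr /= -big_mkcond /=.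
by rewrite subn_gt0 ltn_ord subnKC.
Qed.

Lemma exchange_triangle (V : nmodType) N (P : pred nat) (G : nat -> nat -> V) :
  \sum_(m < N) \sum_(h < N - m | P h) G h m =
  \sum_(h < N | P h) \sum_(m < N - h) G h m.
Proof.
under eq_bigr => m _ do rewrite (big_ord_widen_cond N P (G ^~ m)) ?leq_subr//.
rewrite (exchange_big_dep (fun h : 'I_N => P h)) /=; last by move=> ? ? _ /andP[].
apply: eq_bigr => h Ph.
rewrite (big_ord_widen N (G h)) ?leq_subr//; apply: eq_bigl => m.
by rewrite Ph /= !ltn_subRL addnC.
Qed.

Lemma sum_multiples (V : nmodType) q M (F : nat -> V) : (0 < q)%N ->
  \sum_(h < M | (0 < h)%N && (q %| h)%N) F h =
  \sum_(j < (M.-1 %/ q)%N) F (q * j.+1)%N.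
Proof.
move=> q0; elim: M => [|M IH]; first by rewrite div0n !big_ord0.
rewrite big_mkcond big_ord_recr /= -big_mkcond /= IH.
case: M {IH} => [|M]; first by rewrite /= addr0.
rewrite [M.+1.-1]/= divnS//; case: (boolP (q %| M.+1)%N) => /= [d|_]; last by rewrite addr0.
by rewrite add1n big_ord_recr /= -[(M %/ q).+1%N]add1n -[1%N]/(nat_of_bool true)
  -d -divnS// mulnC divnK.
Qed.

(** As a is prime to q, h |-> h a permutes the residues, so that each complete
    block of q consecutive h contributes the same sum; the last, incomplete block
    is filled up at the price of the successor. *)
Lemma sum_periodic_residue (R : numDomainType) q a N (g : nat -> R) (P : pred nat) :
  (0 < q)%N -> coprime a q -> (forall r, 0 <= g r) ->
  \sum_(h < N | P h) g ((h * a) %% q)%N <=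
  (N %/ q).+1%N%:R * \sum_(r < q) g r.
Proof.
move=> q0 caq g0.
have bij : \sum_(r < q) g ((r * a) %% q)%N = \sum_(r < q) g r.
  pose f (r : 'I_q) := Ordinal (ltn_pmod (r * a) q0).
  have fi : injective f.
    move=> r s /(congr1 val)/= /eqP.
    wlog rs : r s / (s <= r)%N => [h|].
      case/orP: (leq_total s r) => [/h//|/h {}h e]; apply/esym/h.
      by rewrite eq_sym.
    rewrite eqn_mod_dvd ?leq_mul2r ?rs ?orbT// -mulnBl Gauss_dvdl; last first.
      by rewrite coprime_sym.
    move=> d; apply/val_inj/eqP; rewrite eqn_leq rs andbT -subn_eq0.
    apply: contraT; rewrite -lt0n => /dvdn_leq/(_ d).
    move=> h; have := leq_ltn_trans h (leq_ltn_trans (leq_subr _ _) (ltn_ord r)).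
    by rewrite ltnn.
  rewrite [RHS](reindex_onto f (invF fi)) /=; last by move=> i _; rewrite f_invF.
  by apply: eq_bigl => i; rewrite invF_f eqxx.
have blocks k : \sum_(h < k * q) g ((h * a) %% q)%N = k%:R * \sum_(r < q) g r.
  elim: k => [|k IH]; first by rewrite big_ord0 mul0r.
  rewrite mulSnr big_split_ord /= IH -natr1 mulrDl mul1r -bij; congr (_ + _).
  by apply: eq_bigr => i _; rewrite mulnDl mulnAC modnMDl.
rewrite -blocks big_mkcond /=.
have NN : (N <= (N %/ q).+1 * q)%N by rewrite ltnW// ltn_ceil.
rewrite [leRHS](_ : _ = \sum_(0 <= h < ((N %/ q).+1 * q)%N) g ((h * a) %% q)%N); last first.
  by rewrite big_mkord.
rewrite (big_cat_nat (leq0n N) NN)/= big_mkord.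
rewrite -[leLHS]addr0 lerD ?sumr_ge0//.
by apply: ler_sum => i _; case: (P i).
Qed.

End Reindex.

(** * Differencing and slowly varying phases *)

Section Weyl.
Context {R : realType}.
Implicit Types (x y z t c : R) (N K q a : nat).

Lemma conjc_sum (I : Type) (r : seq I) (P : pred I) (F : I -> R[i]) :
  (\sum_(i <- r | P i) F i)^*%C = \sum_(i <- r | P i) (F i)^*%C.
Proof. exact: rmorph_sum. Qed.

Lemma conjcD (u v : R[i]) : (u + v)^*%C = u^*%C + v^*%C.
Proof. exact: rmorphD. Qed.

Lemma conjcM (u v : R[i]) : (u * v)^*%C = u^*%C * v^*%C.
Proof. exact: rmorphM. Qed.

Lemma cabs_conj (u : R[i]) : cabs u^*%C = cabs u.
Proof. by case: u => a b /=; rewrite sqrrN. Qed.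

(** Weyl differencing: the off-diagonal terms of |sum u|^2 come in conjugate
    pairs. *)
Lemma sqr_sum_unimodular_le (u : nat -> R[i]) N :
  (forall n, u n * (u n)^*%C = 1) ->
  cabs (\sum_(n < N) u n) ^+ 2 <=
  N%:R + 2 * cabs (\sum_(n < N) \sum_(m < n) u n * (u m)^*%C).
Proof.
move=> u1; set S := \sum_(n < N) u n; set D := (X in 2 * cabs X).
have -> : cabs S ^+ 2 = cabs (S * S^*%C) by rewrite cabsM cabs_conj expr2.
have -> : S * S^*%C = N%:R + D + D^*%C.
  rewrite {}/S {}/D; elim: N => [|N IH].
    by rewrite !big_ord0 mul0r conjc0 !addr0.
  rewrite !big_ord_recr /= -mulr_sumr -conjc_sum.
  rewrite !conjcD conjcM conjcK mulrDl !mulrDr IH u1 -natr1; ring.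
rewrite (le_trans (cabsD _ _))// (le_trans (lerD (cabsD _ _) (lexx _)))//.
by rewrite cabs_conj cabs_nat; lra.
Qed.

(** A variant of the Kusmin-Landau inequality.  Each term is
    e(f j) = (e(f j.+1) - e(f j)) / g j with g j = e(f j.+1 - f j) - 1, and
    summation by parts costs only the variation of the coefficients 1 / g j,
    which is small when the second differences of f are. *)
Lemma slow_phase_sum_le (f : nat -> R) (theta eta : R) n :
  0 < theta -> 0 <= eta ->
  (forall j, (j < n)%N -> theta <= cabs (phase (f j.+1 - f j) - 1)) ->
  (forall j, (j < n)%N ->
     `|(f j.+2 - f j.+1) - (f j.+1 - f j)| <= eta) ->
  cabs (\sum_(j < n) phase (f j)) <= 2 / theta + n%:R * (8 * eta / theta ^+ 2).
Proof.
move=> th0 eta0; case: n => [|n] hth heta.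
  by rewrite big_ord0 ComplexField.Normc.normc0 mul0r addr0 divr_ge0// ltW.
pose g j := phase (f j.+1 - f j) - 1.
have cg j : (j <= n)%N -> cabs (g j)^-1 <= theta^-1.
  move=> jn; rewrite ComplexField.Normc.normcV lef_pV2 ?posrE ?hth//.
  exact: lt_le_trans (hth _ _).
have g0 j : (j <= n)%N -> g j != 0.
  move=> jn; apply/eqP => h; have := hth j jn.
  by rewrite -/(g j) h ComplexField.Normc.normc0 leNgt th0.
have ug j : (j <= n)%N -> phase (f j) = (g j)^-1 * phase (f j.+1) - (g j)^-1 * phase (f j).
  move=> jn; rewrite -mulrBr; apply: (mulfI (g0 j jn)).
  by rewrite mulrA divff ?g0// mul1r mulrBl -phaseD subrK mul1r.
have dg j : (j < n)%N -> cabs ((g j)^-1 - (g j.+1)^-1) <= 8 * eta / theta ^+ 2.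
  move=> jn.
  have -> : (g j)^-1 - (g j.+1)^-1 = (g j.+1 - g j) * ((g j)^-1 * (g j.+1)^-1).
    by field; rewrite !g0// ltnW.
  rewrite !cabsM [theta ^+ 2]expr2 invfM; apply: ler_pM.
  - exact: cabs_ge0.
  - by apply: mulr_ge0; exact: cabs_ge0.
  - have -> : g j.+1 - g j =
       phase (f j.+1 - f j) * (phase ((f j.+2 - f j.+1) - (f j.+1 - f j)) - 1).
      by rewrite /g opprB addrA subrK mulrBr mulr1 -phaseD; congr (phase _ - _); ring.
    rewrite cabsM cabs_phase mul1r (le_trans (phase_sub1_le _))//.
    by rewrite ler_pM2l// heta// ltnW.
  - by apply: ler_pM; rewrite ?cabs_ge0 ?cg// ltnW.
have key m : (m <= n)%N ->
    cabs (\sum_(j < m.+1) phase (f j) - (g m)^-1 * phase (f m.+1)) <=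
    theta^-1 + m%:R * (8 * eta / theta ^+ 2).
  elim: m => [_|m IH mn].
    rewrite big_ord1 [X in cabs (X - _)](ug 0%N)// addrAC subrr add0r cabsN cabsM.
    by rewrite cabs_phase mulr1 mul0r addr0 cg.
  rewrite big_ord_recr /=.
  have -> : \sum_(i < m.+1) phase (f i) + phase (f m.+1) - (g m.+1)^-1 * phase (f m.+2)
     = (\sum_(i < m.+1) phase (f i) - (g m)^-1 * phase (f m.+1)) +
       ((g m)^-1 - (g m.+1)^-1) * phase (f m.+1).
    by rewrite [X in _ + X - _](ug m.+1)//; ring.
  rewrite (le_trans (cabsD _ _))// -[m.+1%:R]natr1 [X in theta^-1 + X]mulrDl mul1r
    addrA lerD ?IH 1?ltnW//.
  by rewrite cabsM cabs_phase mulr1 dg.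
have C0 : 0 <= 8 * eta / theta ^+ 2 by apply: divr_ge0; [exact: mulr_ge0|exact: sqr_ge0].
rewrite -[X in cabs X](subrK ((g n)^-1 * phase (f n.+1))).
rewrite (le_trans (cabsD _ _))// (le_trans (lerD (key n (leqnn n)) (lexx _)))//.
rewrite cabsM cabs_phase mulr1.
rewrite (le_trans (lerD (lexx _) (cg n (leqnn n))))//.
rewrite -[n.+1%:R]natr1 [X in _ <= _ + X]mulrDl mul1r mulrDl mul1r.
by move: (theta^-1) (n%:R * _) C0 => ? ? ?; lra.
Qed.

End Weyl.

(** * A Weyl inequality that sees both coefficients *)

Section Weyl.
Context {R : realType}.
Implicit Types (x y z t c : R) (N K q a : nat).

Lemma weyl_sumE N x t :
  weyl_sum N x t = \sum_(n < N) phase (n.+1%:R * x + n.+1%:R ^+ 2 * t).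
Proof. by rewrite /weyl_sum big_add1 /= big_mkord. Qed.

(** The phase of u_(m+h) conj u_m for u_m the m-th term of the Weyl sum: it is
    linear in m, with slope 2ht. *)
Definition diff_phase x t h m : R :=
  h%:R * x + h%:R ^+ 2 * t + 2 * h%:R * m.+1%:R * t.

Lemma weyl_sum_sqr_le N x t :
  cabs (weyl_sum N x t) ^+ 2 <= N%:R +
   2 * cabs (\sum_(m < N) \sum_(h < N - m | (0 < h)%N) phase (diff_phase x t h m)).
Proof.
rewrite weyl_sumE.
pose u n : R[i] := phase (n.+1%:R * x + n.+1%:R ^+ 2 * t).
have := @sqr_sum_unimodular_le R u N.
rewrite (sum_triangle N (fun n m => u n * (u m)^*%C)) => /(_ _)/le_trans; apply.
  by move=> n; rewrite /u phaseB subrr phase0.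
rewrite lerD2l ler_pM2l//; rewrite le_eqVlt; apply/orP; left; apply/eqP; congr (cabs _).
apply: eq_bigr => m _; apply: eq_bigr => h _.
rewrite /u phaseB; congr phase; rewrite /diff_phase -addSn natrD; ring.
Qed.

Section Rational.
Variables (N K q a : nat) (z x : R).
Hypotheses (q0 : (0 < q)%N) (qK : (q <= K)%N) (caq : coprime a q)
  (zaq : `|q%:R * z - a%:R| <= K%:R^-1) (NK : (8 * N <= K)%N).

Let K0 : (0 < K)%N. Proof. exact: leq_trans qK. Qed.
Let KR : 0 < K%:R :> R. Proof. by rewrite ltr0n K0. Qed.
Let qR : 0 < q%:R :> R. Proof. by rewrite ltr0n q0. Qed.
Let kappa : R := q%:R * z - a%:R.

(** The integer h a - b q is congruent to r modulo q, so its size is at least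
    r or at least q - r; the sum of inverses covers both cases. *)
Lemma nonmultiple_residue_dist (h r : nat) (b : int) :
  r = ((h * a) %% q)%N -> ~~ (q %| h)%N ->
  1 <= `|h%:R * a%:R - b%:~R * q%:R : R| * (r%:R^-1 + (q - r)%:R^-1).
Proof.
move=> rh qh.
have r0 : (0 < r)%N.
  rewrite lt0n; apply: contra qh => /eqP rE.
  by rewrite -(@Gauss_dvdl q h a) 1?coprime_sym// /dvdn -rh rE.
have rq : (r < q)%N by rewrite rh ltn_pmod.
have -> : h%:R * a%:R - b%:~R * q%:R = (((h * a) %/ q)%N%:Z - b)%:~R * q%:R + r%:R :> R.
  rewrite -natrM [in LHS](divn_eq (h * a) q) -rh natrD natrM rmorphB /=; ring.
set l := (_ - b).
have rR : 0 < r%:R :> R by rewrite ltr0n.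
have qrR : 0 < (q - r)%:R :> R by rewrite ltr0n subn_gt0.
have [l0|l0] := lerP 0 l.
  have h1 : r%:R <= `|l%:~R * q%:R + r%:R : R|.
    by rewrite ger0_norm ?lerDr ?addr_ge0 ?mulr_ge0 ?ler0z.
  rewrite -[leLHS](divff (lt0r_neq0 rR)); apply: ler_pM;
    by rewrite ?invr_ge0 ?ler0n ?lerDl ?invr_ge0.
have h1 : (q - r)%:R <= `|l%:~R * q%:R + r%:R : R|.
  have l1 : l%:~R <= -1 :> R by rewrite -[-1]/((-1)%:~R) ler_int; lia.
  have : l%:~R * q%:R + r%:R <= - (q - r)%:R :> R.
    rewrite natrB ?(ltnW rq)// opprB addrC lerD2l -mulN1r ler_pM2r//.
  by move=> h1; rewrite ler_normr lerNr h1 orbT.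
rewrite -[leLHS](divff (lt0r_neq0 qrR)); apply: ler_pM;
  by rewrite ?invr_ge0 ?ler0n ?lerDr ?invr_ge0.
Qed.

(** Here 2ht = h a / q + h kappa / q stays away from the integers, because
    h a / q does. *)
Lemma nonmultiple_sum_le t h r : r = ((h * a) %% q)%N ->
  z = 2 * t -> (h < N)%N -> ~~ (q %| h)%N ->
  cabs (\sum_(m < N - h) phase (diff_phase x t h m)) <=
  8 * q%:R * (r%:R^-1 + (q - r)%:R^-1).
Proof.
move=> rh zt hN qh.
have -> : \sum_(m < N - h) phase (diff_phase x t h m) =
  \sum_(m < N - h) phase (h%:R * x + h%:R ^+ 2 * t + h%:R * z + m%:R * (h%:R * z)).
  by apply: eq_bigr => m _; congr phase; rewrite /diff_phase zt -natr1; ring.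
set S := cabs _.
have := geom_phase_le (h%:R * z) (h%:R * x + h%:R ^+ 2 * t + h%:R * z) (N - h).
rewrite -/S => hS.
have [b hb] := phase_sub1_ge (h%:R * z).
have hr := nonmultiple_residue_dist b rh qh.
set g := r%:R^-1 + _ in hr *; set d := cabs (phase _ - 1) in hS hb.
have S0 : 0 <= S by exact: cabs_ge0.
have g0 : 0 <= g by rewrite addr_ge0 ?invr_ge0.
(* As K >= 8N, the error h kappa moves ha by at most 1/8, while g <= 2. *)
have hk : `|h%:R * kappa| <= 1 / 8.
  rewrite normrM ger0_norm//; apply: (@le_trans _ _ (h%:R * K%:R^-1)).
    by apply: ler_wpM2l.
  rewrite ler_pdivrMr//; have : (8 * h <= K)%N by lia.
  by rewrite -(ler_nat R) natrM; lra.
have h1 : `|h%:R * a%:R - b%:~R * q%:R| <= q%:R * (2 * d) + 1 / 8.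
  have -> : h%:R * a%:R - b%:~R * q%:R = q%:R * (h%:R * z - b%:~R) - h%:R * kappa.
    by rewrite /kappa; ring.
  rewrite (le_trans (ler_normB _ _))// lerD// normrM ger0_norm//.
  by rewrite ler_pM2l.
have r0 : (0 < r)%N.
  rewrite lt0n; apply: contra qh => /eqP rE.
  by rewrite -(@Gauss_dvdl q h a) 1?coprime_sym// /dvdn -rh rE.
have rq : (r < q)%N by rewrite rh ltn_pmod.
have g2 : g <= 2.
  have gr : r%:R^-1 <= 1 :> R by rewrite invf_le1 ?ler1n ?ltr0n.
  have gqr : (q - r)%:R^-1 <= 1 :> R by rewrite invf_le1 ?ler1n ?ltr0n subn_gt0.
  rewrite /g; lra.
have h2 : 1 <= (q%:R * (2 * d) + 1 / 8) * g by exact: le_trans hr (ler_wpM2r g0 h1).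
have h3 : 1 / 2 <= 2 * q%:R * d * g by nra.
have : S * (1 / 2) <= S * (2 * q%:R * d * g) by apply: ler_wpM2l.
have : S * d * (2 * q%:R * g) <= 2 * (2 * q%:R * g).
  by apply: ler_wpM2r => //; rewrite !mulr_ge0// ltW.
have -> : S * (2 * q%:R * d * g) = S * d * (2 * q%:R * g) by ring.
by move=> ? ?; lra.
Qed.

(** Summing over h block by block gives (N / q + 1) q log q, which is at most
    of order K log K. *)
Lemma nonmultiples_total_le t : z = 2 * t ->
  cabs (\sum_(m < N) \sum_(h < N - m | (0 < h)%N && ~~ (q %| h)%N)
     phase (diff_phase x t h m)) <= 18 * K%:R * (1 + ln K%:R).
Proof.
move=> zt.
rewrite (exchange_triangle N (fun h => (0 < h)%N && ~~ (q %| h)%N)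
  (fun h m => phase (diff_phase x t h m))).
rewrite (le_trans (cabs_sum _ _ _))//.
pose g r : R := 8 * q%:R * (r%:R^-1 + (q - r)%:R^-1).
have g0 r : 0 <= g r by rewrite !mulr_ge0 ?addr_ge0 ?invr_ge0// ltW.
apply: (@le_trans _ _ (\sum_(h < N | (0 < h)%N && ~~ (q %| h)%N) g ((h * a) %% q)%N)).
  by apply: ler_sum => h /andP[_ qh]; apply: nonmultiple_sum_le.
rewrite (le_trans (sum_periodic_residue _ (fun h => (0 < h)%N && ~~ (q %| h)%N) _ _ _))//.
rewrite /g -mulr_sumr.
have hs := @sum_inv_dist_le R q.
have lq : ln q%:R <= ln K%:R :> R by rewrite ler_ln ?posrE// ler_nat.
have l0 : 0 <= ln q%:R :> R by rewrite ln_ge0// ler1n.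
have h1 : (N %/ q).+1%:R * q%:R * 8 <= 9 * K%:R :> R.
  rewrite -!natrM ler_nat; have := leq_trunc_div N q; rewrite mulSn; nia.
set A := \sum_(_ < q) _ in hs *.
have s0 : 0 <= A by rewrite sumr_ge0// => i _; rewrite addr_ge0 ?invr_ge0.
have -> : (N %/ q).+1%:R * (8 * q%:R * A) = (N %/ q).+1%:R * q%:R * 8 * A by ring.
apply: (@le_trans _ _ (9 * K%:R * A)); first exact: ler_wpM2r.
have -> : 18 * K%:R * (1 + ln K%:R) = 9 * K%:R * (2 * (1 + ln K%:R)) :> R by ring.
by apply: ler_wpM2l; [rewrite mulr_ge0 ?ltW|lra].
Qed.

Let y : R := q%:R * x + q%:R * a%:R / 2.

(** Along the multiples of q the rational part of the quadratic term,
    q a j^2 / 2, may be replaced by the linear q a j / 2, since j^2 - j is even.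
    What remains is linear with slope close to y. *)
Lemma multiple_phaseE t j m : z = 2 * t ->
  phase (diff_phase x t (q * j.+1) m) =
  phase (j.+1%:R * (y + m.+1%:R * kappa) + j.+1%:R ^+ 2 * (q%:R * kappa / 2)).
Proof.
move=> zt.
rewrite -[RHS](phaseDnat _ (q * a * 'C(j.+1, 2) + m.+1 * j.+1 * a)%N); congr phase.
have b2 : ('C(j.+1, 2))%:R = j.+1%:R * j%:R / 2 :> R.

  have : ('C(j.+1, 2) * 2 = j.+1 * j)%N by rewrite bin2 muln2 halfK /= oddM /= andNb subn0.
  by move=> /(congr1 (fun n => n%:R : R)); rewrite !natrM => <-; field.
rewrite /diff_phase /kappa /y natrD !natrM b2.
have -> : t = z / 2 by rewrite zt; field.
rewrite -[j.+1%:R]natr1; by field.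
Qed.

Lemma multiples_sum_trivial t m :
  cabs (\sum_(h < N - m | (0 < h)%N && (q %| h)%N) phase (diff_phase x t h m)) <=
  N%:R / q%:R.
Proof.
rewrite (sum_multiples _ (fun h => phase (diff_phase x t h m)))//.
rewrite (le_trans (cabs_sum _ _ _))//.
under eq_bigr do rewrite cabs_phase.
rewrite sumr_const card_ord ler_pdivlMr// -natrM ler_nat.
by rewrite (leq_trans (leq_trunc_div _ _))// (leq_trans (leq_pred _))// leq_subr.
Qed.

(** The increments of the phase differ from y by at most 2N / K <= theta / 16,
    and their own variation q kappa is so small that its total over
    the at most N / q terms is again of order theta. *)
Lemma multiples_sum_le t m (theta := cabs (phase y - 1)) :
  z = 2 * t -> 0 < theta -> 32 * N%:R <= theta * K%:R ->
  cabs (\sum_(h < N - m | (0 < h)%N && (q %| h)%N) phase (diff_phase x t h m)) <=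
  5 / theta.
Proof.
move=> zt th0 thN.
rewrite (sum_multiples _ (fun h => phase (diff_phase x t h m)))//.
set n := ((N - m).-1 %/ q)%N.
under eq_bigr do rewrite multiple_phaseE//.
pose f j : R := j.+1%:R * (y + m.+1%:R * kappa) + j.+1%:R ^+ 2 * (q%:R * kappa / 2).
have fS j : f j.+1 - f j = y + (m.+1%:R + q%:R * (j%:R + 3 / 2)) * kappa.
  by rewrite /f -[j.+2%:R]natr1 -[j.+1%:R]natr1; field.
have nq : (n * q <= (N - m).-1)%N by rewrite leq_trunc_div.
have kK : `|kappa| <= K%:R^-1 by [].
have th2 : 0 < theta / 2 by rewrite divr_gt0.
have q1 : 1 <= q%:R :> R by rewrite ler1n.
have := @slow_phase_sum_le R f (theta / 2) (q%:R / K%:R) n th2.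
move=> /(_ _ _ _)/le_trans; apply.
- by rewrite divr_ge0// ltW.
- move=> j jn; rewrite fS.
  set xi := _ * kappa.
  have jN : m.+1%:R + q%:R * (j%:R + 3 / 2) <= 2 * N%:R :> R.
    have qN : (q * j.+1 + m.+1 <= N)%N.
      have : (q * j.+1 <= n * q)%N by rewrite mulnC leq_mul2r jn orbT.
      have : (0 < q * j.+1)%N by rewrite muln_gt0 q0.
      lia.
    have : (q * j.+1 + m.+1)%:R <= N%:R :> R by rewrite ler_nat.
    rewrite natrD natrM -[j.+1%:R]natr1.
    have : 0 <= q%:R * j%:R :> R by rewrite mulr_ge0// ltW.
    have : 0 <= m.+1%:R :> R by []. lra.
  have hxi : `|xi| <= 2 * N%:R / K%:R.
    rewrite normrM ger0_norm; last by rewrite addr_ge0// mulr_ge0 ?addr_ge0 ?ltW.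
    apply: ler_pM => //; rewrite addr_ge0// mulr_ge0 ?addr_ge0 ?ltW//.
  have hd : 8 * `|xi| <= theta / 2.
    apply: (@le_trans _ _ (8 * (2 * N%:R / K%:R))); first by rewrite ler_pM2l.
    rewrite mulrA ler_pdivrMr//; lra.
  have := phase_sub1_le xi.
  have -> : phase (y + xi) - 1 = (phase y - 1) + phase y * (phase xi - 1).
    by rewrite phaseD; ring.
  have h2 : theta <= cabs (phase y - 1 + phase y * (phase xi - 1)) +
      cabs (phase xi - 1).
    rewrite -[X in _ + X]mul1r -(cabs_phase y) -cabsM.
    rewrite -[X in X <= _]/(cabs (phase y - 1)).
    by rewrite -{1}[phase y - 1](addrK (phase y * (phase xi - 1))) cabsB.
  by lra.
- move=> j jn; rewrite !fS -[j.+1%:R]natr1.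
  have -> : y + (m.+1%:R + q%:R * (j%:R + 1 + 3 / 2)) * kappa -
    (y + (m.+1%:R + q%:R * (j%:R + 3 / 2)) * kappa) = q%:R * kappa by ring.
  by rewrite normrM ger0_norm// ler_pM2l.
have nN : n%:R * q%:R <= N%:R :> R by rewrite -natrM ler_nat; lia.
have h32 : n%:R * (8 * (q%:R / K%:R)) <= theta / 4.
  have -> : n%:R * (8 * (q%:R / K%:R)) = 8 * (n%:R * q%:R) / K%:R :> R by ring.
  by rewrite ler_pdivrMr//; lra.
have -> : n%:R * (8 * (q%:R / K%:R) / (theta / 2) ^+ 2) =
   n%:R * (8 * (q%:R / K%:R)) * (4 / theta ^+ 2).
  by field; rewrite gt_eqF//= gt_eqF.
apply: (@le_trans _ _ (2 / (theta / 2) + theta / 4 * (4 / theta ^+ 2))).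
  by rewrite lerD2l ler_wpM2r// divr_ge0// sqr_ge0.
rewrite le_eqVlt; apply/orP; left; apply/eqP.
by field; rewrite gt_eqF.
Qed.

End Rational.

(** The first bound limits the size of q, the second one the distance of
    q x + q a / 2 to the integers, and hence that of 2 q x. *)
Lemma weyl_inequality N K x t : (0 < K)%N -> (8 * N <= K)%N -> 0 <= t ->
  exists q a : nat, [/\ (0 < q <= K)%N,
   cabs (weyl_sum N x t) ^+ 2 <=
     37 * K%:R * (1 + ln K%:R) + 2 * N%:R * (N%:R / q%:R) &
   let theta := cabs (phase (q%:R * x + q%:R * a%:R / 2) - 1) in
   0 < theta -> 32 * N%:R <= theta * K%:R ->
   cabs (weyl_sum N x t) ^+ 2 <= 37 * K%:R * (1 + ln K%:R) + 2 * N%:R * (5 / theta)].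
Proof.
move=> K0 NK t0.
have [q [a [qK caq zaq]]] : exists q a, [/\ (0 < q <= K)%N, coprime a q &
    `|q%:R * (2 * t) - a%:R| <= K%:R^-1] by apply: dirichlet_coprime; rewrite ?mulr_ge0.
have /andP[q0 qK'] := qK.
have main B : (forall m : nat,
   cabs (\sum_(h < N - m | (0 < h)%N && (q %| h)%N) phase (diff_phase x t h m)) <= B) ->
   cabs (weyl_sum N x t) ^+ 2 <= 37 * K%:R * (1 + ln K%:R) + 2 * N%:R * B.
  move=> hB; rewrite (le_trans (weyl_sum_sqr_le _ _ _))//.
  have -> : \sum_(m < N) \sum_(h < N - m | (0 < h)%N) phase (diff_phase x t h m) =
     \sum_(m < N) \sum_(h < N - m | (0 < h)%N && ~~ (q %| h)%N) phase (diff_phase x t h m)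
     + \sum_(m < N) \sum_(h < N - m | (0 < h)%N && (q %| h)%N) phase (diff_phase x t h m).
    rewrite -big_split /=; apply: eq_bigr => m _.
    by rewrite (bigID (fun h : 'I_(N - m) => (q %| h)%N)) /= addrC.
  have hA := @nonmultiples_total_le N K q a (2 * t) x q0 qK' caq zaq NK t erefl.
  set A := \sum_(_ < _) \sum_(_ < _ | _) _ in hA *; set D := \sum_(_ < _) _.
  have hD : cabs D <= N%:R * B.
    rewrite (le_trans (cabs_sum _ _ _))//.
    by rewrite -[N in N%:R]card_ord mulr_natl -sumr_const; apply: ler_sum => m _; exact: hB.
  have NK' : N%:R <= K%:R * (1 + ln K%:R) :> R.
    have K1 : 1 <= K%:R :> R by rewrite ler1n.
    apply: (@le_trans _ _ K%:R); first by rewrite ler_nat; lia.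
    by rewrite ler_peMr// lerDl ln_ge0.
  have := cabsD A D; lra.
exists q, a; split => //.
  by apply: main => m; exact: multiples_sum_trivial.
move=> theta th0 thN; apply: main => m; exact: (multiples_sum_le (z := 2 * t) (K := K)).
Qed.

End Weyl.

(** * Large Weyl sums force rational approximation *)

Section Asymptotics.
Context {R : realType}.
Implicit Types (c d : R).

Lemma powR_nat_large c d : 0 < d ->
  exists N0 : nat, forall N : nat, (N0 <= N)%N -> c <= N%:R `^ d.
Proof.
move=> d0; pose v : R := `|c| `^ d^-1; exists (Num.truncn v).+1 => N hN.
have vN : v <= N%:R.
  apply: ltW; apply: lt_le_trans (truncnS_gt v) _; by rewrite ler_nat.
apply: le_trans (ler_norm c) _.
have -> : `|c| = v `^ d by rewrite -powRrM mulVf ?gt_eqF// powRr1.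
by apply: ge0_ler_powR => //; rewrite ?nnegrE ?powR_ge0// ltW.
Qed.

Lemma ln_le_powR d (x : R) : 0 < d -> 0 < x -> ln x <= d^-1 * x `^ d.
Proof.
move=> d0 x0; rewrite mulrC ler_pdivlMr// mulrC -ln_powR.
by apply/ltW/ln_sublinear/powR_gt0.
Qed.

End Asymptotics.

Section Approximation.
Context {R : realType}.
Implicit Types (alpha eps x t : R).

Lemma phase_double_sub1_le (y : R) :
  cabs (phase (2 * y) - 1) <= 2 * cabs (phase y - 1).
Proof.
have -> : phase (2 * y) - 1 = (phase y + 1) * (phase y - 1).
  by rewrite mulr2n mulrDl mul1r phaseD; ring.
rewrite cabsM ler_wpM2r ?cabs_ge0// (le_trans (cabsD _ _))// cabs_phase.
by rewrite ComplexField.Normc.normc1.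
Qed.

(** The level K is taken just below N^(2 alpha): then K log K is negligible
    against |w_N|^2 >= N^(2 alpha) / 4 and the two bounds of the Weyl inequality
    give the two conclusions. *)
Lemma large_weyl_sum_near_rational alpha eps :
  1 + eps < 2 * alpha -> alpha <= 1 -> 0 < eps ->
  exists2 D : R, 0 < D & exists N0 : nat, forall N x t, (N0 <= N)%N -> 0 <= t ->
    N%:R `^ alpha / 2 <= cabs (weyl_sum N x t) ->
    exists (q : nat) (b : int), [/\ (0 < q)%N,
      q%:R <= N%:R `^ (2 - 2 * alpha + eps) &
      `|2 * q%:R * x - b%:~R| <= D * N%:R `^ (1 - 2 * alpha + eps)].
Proof.
move=> alo ahi eps0.
(* 320 = 2 * 2 * 80: passing from y to 2 y, from a chord to a distance, and the
   bound on theta below. *)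
exists 320; first by lra.
have [N1 hN1] := @powR_nat_large R 8 (2 * alpha - eps - 1) ltac:(lra).
pose C : R := 37 * 2 * 8 * (2 + (eps / 2)^-1 * 2).
have [N2 hN2] := @powR_nat_large R C (eps / 2) ltac:(lra).
have [N3 hN3] := @powR_nat_large R 16 eps eps0.
exists (maxn 1 (maxn N1 (maxn N2 N3))) => N x t.
rewrite !geq_max => /and4P[N0 {}/hN1 h1 {}/hN2 h2 {}/hN3 h3] t0 hw.
have X0 : 0 < N%:R :> R by rewrite ltr0n.
have X1 : 1 <= N%:R :> R by rewrite ler1n.
have XD r s : N%:R `^ (r + s) = N%:R `^ r * N%:R `^ s :> R.
  by rewrite powRD//; apply/implyP => _; rewrite gt_eqF.
set X : R := N%:R in X0 X1 XD h1 h2 h3 hw *.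
have P1 d : 0 <= d -> 1 <= X `^ d by move=> d0; rewrite -[leLHS](powRr0 X) ler_powR.
pose A := X `^ (2 * alpha - eps).
have A0 : 0 < A by apply: powR_gt0.
pose K := (Num.truncn A).+1.
have KA : A <= K%:R by apply/ltW/truncnS_gt.
have A1 : 8 * X <= A.
  rewrite /A (_ : 2 * alpha - eps = (2 * alpha - eps - 1) + 1); last by ring.
  by rewrite XD powRr1 ?(ltW X0)// ler_pM2r.
have KA2 : K%:R <= 2 * A.
  have : (Num.truncn A)%:R <= A by rewrite truncn_le ltW.
  by rewrite /K -natr1; lra.
have NK : (8 * N <= K)%N.
  by rewrite -(ler_nat R) natrM; apply: le_trans KA.
have [q [a [/andP[q0 qK] hq hth]]] := weyl_inequality x (isT : (0 < K)%N) NK t0.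
have w2 : X `^ (2 * alpha) / 4 <= cabs (weyl_sum N x t) ^+ 2.
  have -> : X `^ (2 * alpha) / 4 = (X `^ alpha / 2) ^+ 2.
    by rewrite mulr2n mulrDl mul1r XD expr2; field.
  by rewrite ler_sqr ?nnegrE ?cabs_ge0// divr_ge0// powR_ge0.
have E : X `^ (2 * alpha) = A * X `^ eps by rewrite -XD; congr (_ `^ _); ring.
have log : 37 * K%:R * (1 + ln K%:R) <= X `^ (2 * alpha) / 8.
  have lK : 1 + ln K%:R <= (2 + (eps / 2)^-1 * 2) * X `^ (eps / 2).
    have P2 : 1 <= X `^ (eps / 2) by apply: P1; lra.
    have : ln K%:R <= ln (X `^ 2 * 2).
      rewrite ler_ln ?posrE ?ltr0n ?mulr_gt0 ?powR_gt0//.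
      rewrite (le_trans KA2)// mulrC ler_pM2r// ler_powR//; lra.
    rewrite lnM ?posrE ?powR_gt0// ln_powR.
    have : ln 2 <= 1 :> R by have := @le_ln1Dx R 1; rewrite (_ : 1 + 1 = 2)//; apply; lra.
    have := @ln_le_powR R (eps / 2) X ltac:(lra) X0.
    move: (ln X) (ln 2) (ln _) (X `^ _) P2 (eps / 2)^-1 => l1 l2 l3 P HP u.
    by move=> *; lra.
  have K37 : 37 * K%:R <= 37 * 2 * A by lra.
  have l0 : 0 <= 1 + ln K%:R :> R by rewrite addr_ge0// ln_ge0// ler1n.
  rewrite (le_trans (ler_wpM2r l0 K37))//.
  have A37 : 0 <= 37 * 2 * A by lra.
  rewrite (le_trans (ler_wpM2l A37 lK))// E.
  have -> : X `^ eps = X `^ (eps / 2) * X `^ (eps / 2).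
    by rewrite -XD; congr (_ `^ _); field.
  rewrite ler_pdivlMr//.
  set P := X `^ (eps / 2) in h2 *.
  have P0 : 0 <= A * P by rewrite mulr_ge0 ?powR_ge0// ltW.
  have := ler_wpM2l P0 h2; rewrite /C; move: (eps / 2)^-1 => ?.
  lra.
have q0R : 0 < q%:R :> R by rewrite ltr0n.
have X2a : X `^ (2 * alpha) > 0 by apply: powR_gt0.
have X2 : X `^ (2 - 2 * alpha) * X `^ (2 * alpha) = X * X.
  by rewrite -XD subrK -[RHS]expr2 -powR_mulrn ?(ltW X0).
have X12 : X `^ (1 - 2 * alpha) * X `^ (2 * alpha) = X.
  by rewrite -XD subrK powRr1 ?ltW.
have qle : q%:R <= X `^ (2 - 2 * alpha + eps).
  rewrite XD.
  have h : q%:R * X `^ (2 * alpha) <= 16 * (X * X).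
    have : X `^ (2 * alpha) / 8 <= 2 * (X * X) / q%:R.
      by have := le_trans w2 hq; rewrite -/X -!mulrA; lra.
    by rewrite ler_pdivlMr//; lra.
  rewrite -X2 mulrA ler_pM2r// in h.
  by apply: (le_trans h); rewrite mulrC ler_wpM2l// powR_ge0.
exists q.
set y := q%:R * x + q%:R * a%:R / 2 in hth.
set theta := cabs (phase y - 1) in hth.
have th : theta <= 80 * X `^ (1 - 2 * alpha + eps).
  have [th0|th0] := ltP 0 theta; last first.
    by rewrite (le_trans th0)// mulr_ge0// powR_ge0.
  have [h|h] := leP (32 * X) (theta * K%:R).
    have := hth th0 h; move/(le_trans w2) => h4.
    have h5 : X `^ (2 * alpha) / 8 <= 10 * X / theta by move: h4; rewrite -/X !mulrA; lra.
    rewrite ler_pdivlMr// -{2}X12 mulrA in h5.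
    have h6 : theta <= 80 * X `^ (1 - 2 * alpha).
      rewrite -(ler_pM2r X2a); lra.
    rewrite (le_trans h6)// (XD (1 - 2 * alpha) eps) ler_pM2l// ler_peMr ?powR_ge0//.
    by apply: P1; exact: ltW.
  have h4 : theta * A <= 32 * X by apply: ltW; apply: le_lt_trans h; rewrite ler_pM2l.
  have AX : X `^ (1 - 2 * alpha + eps) * A = X.
    by rewrite -XD -[RHS]powRr1 ?ltW//; congr (_ `^ _); ring.
  rewrite -(ler_pM2r A0) -mulrA AX; lra.
have [b hb] := phase_sub1_ge (2 * y).
exists (b - (q * a)%N%:Z); split => //.
have -> : 2 * q%:R * x - (b - (q * a)%N%:Z)%:~R = 2 * y - b%:~R.
  rewrite rmorphB /= -[(q * a)%N%:Z%:~R]/((q * a)%N%:R) natrM /y; by field.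
rewrite (le_trans hb)//; have := phase_double_sub1_le y.
by rewrite -/theta; lra.
Qed.

End Approximation.

(** * Hausdorff null sets *)

Section HausdorffNull.
Local Open Scope classical_set_scope.
Context {R : realType} {V : normedModType R}.
Implicit Types (A S : set V) (s d : R).

Lemma diameter_ge0 A : (0 <= diameter A)%E.
Proof. by rewrite /diameter le_max lexx. Qed.

Lemma diameter_le A d : 0 <= d ->
  (forall x y, A x -> A y -> `|x - y| <= d) -> (diameter A <= d%:E)%E.
Proof.
move=> d0 h; rewrite /diameter ge_max lee_fin d0 /=.
by apply: ge_ereal_sup => _ [x Ax [y Ay <-]]; rewrite lee_fin h.
Qed.

Lemma dist_le_diameter A d x y :
  (diameter A <= d%:E)%E -> A x -> A y -> `|x - y| <= d.
Proof.
move=> h Ax Ay; rewrite -lee_fin; apply: le_trans h.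
rewrite /diameter le_max; apply/orP; right; apply: ereal_sup_ubound.
by exists x => //; exists y.
Qed.

Lemma hausdorff_gauge_ge0 s A : (0 <= hausdorff_gauge s A)%E.
Proof. by rewrite /hausdorff_gauge; case: ifP => // _; exact: poweR_ge0. Qed.

Lemma hausdorff_gauge_le s A d : 0 <= s -> (diameter A <= d%:E)%E ->
  (hausdorff_gauge s A <= (d `^ s)%:E)%E.
Proof.
move=> s0 h; rewrite /hausdorff_gauge; case: ifP => _.
  by rewrite lee_fin powR_ge0.
have d0 : 0 <= d by rewrite -lee_fin (le_trans (diameter_ge0 A) h).
have [r rE] : exists r, diameter A = r%:E.
  have := diameter_ge0 A; move: h.
  by case: (diameter A) => // r _ _; exists r.
have r0 : 0 <= r by have := diameter_ge0 A; rewrite rE lee_fin.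
rewrite rE lee_fin in h.
by rewrite rE poweR_EFin lee_fin ge0_ler_powR.
Qed.

Lemma hausdorff_premeasure_ge0 s d S : (0 <= hausdorff_premeasure s d S)%E.
Proof.
apply: le_ereal_inf_tmp => _ [F _ <-].
by apply: nneseries_ge0 => k _ _; exact: hausdorff_gauge_ge0.
Qed.

Lemma hausdorff_measure_eq0 s S :
  (forall d e : R, 0 < d -> 0 < e -> exists F : nat -> set V,
     [/\ S `<=` \bigcup_k F k, forall k, (diameter (F k) <= d%:E)%E &
       (\sum_(0 <= k <oo) hausdorff_gauge s (F k) <= e%:E)%E]) ->
  hausdorff_measure s S = 0%E.
Proof.
move=> h; apply/eqP; rewrite eq_le; apply/andP; split; last first.
  apply: (le_trans (hausdorff_premeasure_ge0 s 1 S)).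
  by apply: ereal_sup_ubound; exists 1 => //=.
apply: ge_ereal_sup => _ [d /= d0 <-]; apply/lee_addgt0Pr => e e0; rewrite add0e.
have [F [SF Fd Fe]] := h d e d0 e0.
by apply: le_trans Fe; apply: ereal_inf_lbound; exists F.
Qed.

Lemma nneseries_le_partial (f : nat -> \bar R) (M : \bar R) :
  (forall n, 0 <= f n)%E -> (forall n, \sum_(0 <= i < n) f i <= M)%E ->
  (\sum_(0 <= i <oo) f i <= M)%E.
Proof.
move=> f0 h; apply: lime_le; first by apply: is_cvg_nneseries.
by apply: nearW => n; exact: h.
Qed.

(** The convergence half of the Borel-Cantelli lemma for Hausdorff measure: the
    tail of the families from any index on is a cover, of arbitrarily small cost. *)
Lemma hausdorff_limsup_null s S (n : nat -> nat) (G : nat -> nat -> set V)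
    (r : nat -> nat -> R) (C rho : R) :
  0 <= s -> 0 <= C -> 0 <= rho < 1 ->
  (forall k j, (j < n k)%N -> (diameter (G k j) <= (r k j)%:E)%E) ->
  (forall d, 0 < d -> exists k0, forall k j, (k0 <= k)%N -> (j < n k)%N -> r k j <= d) ->
  (forall k, \sum_(j < n k) r k j `^ s <= C * rho ^+ k) ->
  (forall x, S x -> forall k0, exists k, (k0 <= k)%N /\ exists2 j, (j < n k)%N & G k j x) ->
  hausdorff_measure s S = 0%E.
Proof.
move=> s0 C0 /andP[rho0 rho1] Gr rd rsum SG.
apply: hausdorff_measure_eq0 => d e d0 e0.
have [k1 hk1] := rd d d0.
have [k2 hk2] : exists k2 : nat, C * rho ^+ k2 / (1 - rho) <= e.
  have /cvgrPdist_le/(_ (e * (1 - rho))) : (fun k => C * rho ^+ k) @ \oo --> C * 0.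
    apply: cvgM; first exact: cvg_cst.
    by apply: cvg_expr; rewrite ger0_norm.
  have er : 0 < e * (1 - rho) by rewrite mulr_gt0// subr_gt0.
  move=> /(_ er)[k _ hk]; exists k; have /= := hk k (leqnn k).
  rewrite mulr0 sub0r normrN ger0_norm ?mulr_ge0 ?exprn_ge0// => h.
  by rewrite ler_pdivrMr// subr_gt0.
pose k0 := maxn k1 k2.
pose H (p : nat * nat) : set V :=
  if (k0 <= p.1)%N && (p.2 < n p.1)%N then G p.1 p.2 else set0.
have /card_esym/ppcard_eqP[f] := card_nat2.
exists (H \o f); split.
- move=> x Sx; have [k [kk0 [j jn Gx]]] := SG x Sx k0.
  exists (f^-1%FUN (k, j)) => //=.
  by rewrite invK ?inE// /H /= kk0 jn.
- move=> i /=; rewrite /H; case: ifP => [/andP[h1 h2]|_].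
    apply: le_trans (Gr _ _ h2) _; rewrite lee_fin; apply: hk1 h2.
    exact: leq_trans (leq_maxl _ _) h1.
  by apply: diameter_le; first exact: ltW.
pose a (p : nat * nat) := hausdorff_gauge s (H p).
have a0 p : (0 <= a p)%E by exact: hausdorff_gauge_ge0.
have -> : (\sum_(0 <= k <oo) hausdorff_gauge s ((H \o f) k) =
   \sum_(0 <= k <oo) \sum_(0 <= j <oo) a (k, j))%E.
  rewrite nneseries_esumT; last by move=> k; exact: hausdorff_gauge_ge0.
  rewrite -(reindex_esum setT setT f a)//.
  rewrite nneseries_esumT; last by move=> k; apply: nneseries_ge0.
  under [RHS]eq_esum do rewrite nneseries_esumT//.
  rewrite esum_esum//; congr (esum _ _).
    by apply/seteqP; split => // -[? ?].
have g0 : hausdorff_gauge s (set0 : set V) = 0%E by rewrite /hausdorff_gauge eqxx.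
have inner k : (\sum_(0 <= j <oo) a (k, j) <=
    (if (k0 <= k)%N then C * rho ^+ k else 0)%:E)%E.
  apply: nneseries_le_partial => // m; case: ifPn => kk0; last first.
    by rewrite big1// => j _; rewrite /a /H /= (negPf kk0) /= g0.
  apply: (@le_trans _ _ (\sum_(0 <= j < n k) (r k j `^ s)%:E)%E).
    apply: (@le_trans _ _ (\sum_(0 <= j < m | (j < n k)%N) (r k j `^ s)%:E)%E).
      rewrite [leRHS]big_mkcond /=; apply: lee_sum => j _.
      rewrite /a /H /= kk0 /=; case: ifP => jn; last by rewrite g0.
      by apply: hausdorff_gauge_le => //; exact: Gr.
    rewrite (@big_nat_widen _ _ _ 0 m (maxn m (n k))) ?leq_maxl//.
    rewrite [leRHS](@big_nat_widen _ _ _ 0 (n k) (maxn m (n k))) ?leq_maxr//.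
    rewrite big_mkcond [leRHS]big_mkcond; apply: lee_sum => j _ /=.
    by case: (j < n k)%N; case: (j < m)%N; rewrite //= lee_fin powR_ge0.
  by rewrite sumEFin lee_fin big_mkord.
apply: (@le_trans _ _ (\sum_(0 <= k <oo) (if (k0 <= k)%N then C * rho ^+ k else 0)%:E)%E).
  by apply: lee_nneseries => k _; [move=> _; apply: nneseries_ge0|exact: inner].
apply: nneseries_le_partial => [k|m].
  by case: ifP; rewrite lee_fin// mulr_ge0// exprn_ge0.
rewrite sumEFin lee_fin; apply: le_trans hk2.
have r1 : 0 < 1 - rho by rewrite subr_gt0.
rewrite ler_pdivlMr//.
have key : forall m, (\sum_(0 <= k < m) (if (k0 <= k)%N then C * rho ^+ k else 0)) * (1 - rho)
   <= C * (rho ^+ k2 - rho ^+ maxn k2 m).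
  elim=> [|l IH]; first by rewrite big_nil mul0r maxn0 subrr mulr0.
  rewrite big_nat_recr//= mulrDl.
  have pl : forall i j, (i <= j)%N -> rho ^+ j <= rho ^+ i.
    by move=> i j ij; apply: ler_wiXn2l => //; exact: ltW.
  case: ifP => h.
    have k2l : (k2 <= l)%N by apply: leq_trans h; exact: leq_maxr.
    move: IH; rewrite (maxn_idPr k2l) (maxn_idPr (leqW k2l)) exprS; lra.
  rewrite mul0r addr0; apply: le_trans IH _.
  by apply: ler_wpM2l => //; rewrite lerD2l lerN2 pl// geq_max leq_maxl leq_max leqnSn orbT.
rewrite (le_trans (key m))// ler_wpM2l// lerBlDr lerDl exprn_ge0//.
Qed.

End HausdorffNull.

(** * The upper bound *)

Section UpperBound.
Local Open Scope classical_set_scope.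
Context {R : realType}.
Implicit Types (alpha eps x t s : R).

Lemma infinite_nat_ge (A : set nat) M : infinite_set A ->
  exists N, (M <= N)%N /\ A N.
Proof.
move=> Ainf; apply: contrapT => /forallNP h; apply: Ainf.
apply: (sub_finite_set _ (finite_II M)) => N AN /=.
by rewrite ltnNge; apply/negP => MN; apply: (h N).
Qed.

Lemma real_itv_int_le (b : int) (m : nat) :
  -1 < b%:~R :> R -> b%:~R < m%:R + 1 :> R -> exists2 c : nat, (c <= m)%N & b = c.
Proof.
move=> b0 bm; have {}b0 : -1 < b.
  by rewrite -(ltr_int R) [ltLHS]rmorphN.
have {}bm : b < m%:Z + 1 by rewrite -(ltr_int R) rmorphD.
by case: b b0 bm => // c _ h; exists c => //; lia.
Qed.

Lemma sum_ord_divmod (F : nat -> nat -> R) a b : (0 < b)%N ->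
  \sum_(j < a * b) F (j %/ b)%N (j %% b)%N = \sum_(i < a) \sum_(j < b) F i j.
Proof.
move=> b0; elim: a => [|a IH]; first by rewrite !big_ord0.
rewrite mulSnr big_split_ord /= IH big_ord_recr /=; congr (_ + _).
apply: eq_bigr => j _.
by rewrite divnMDl// modnMDl divn_small// modn_small// addn0.
Qed.

Lemma large_weyl_setP alpha x M : large_weyl_set alpha x -> (0 < M)%N ->
  0 <= x <= 1 /\ exists N t, [/\ (M <= N)%N, 0 <= t &
    N%:R `^ alpha / 2 <= cabs (weyl_sum N x t)].
Proof.
move=> [/= x01 xinf] M0; split; first by move: x01; rewrite in_itv.
have [N [MN /= hN]] := infinite_nat_ge M xinf.
have NR : 0 < N%:R :> R by rewrite ltr0n (leq_trans M0).
have P0 : 0 < N%:R `^ alpha :> R by apply: powR_gt0.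
have : ((N%:R `^ alpha / 2)%:E < weyl_sup N x)%E.
  by apply: lt_le_trans hN; rewrite lte_fin; lra.
move=> /ereal_sup_gt[_ [t /= t01 <-]]; rewrite lte_fin => h.
exists N, t; split => //; last exact: ltW.
by move: t01; rewrite in_itv /= => /andP[/ltW].
Qed.

(** Only the numerators b <= 2q are charged.  There are at most 3q of them, so the
    denominator q costs 3 q^(1 - s) delta^s; the two summands on the right bound
    q^(1 - s) for s >= 1 and for s <= 1. *)
Lemma near_rational_cost s (delta : R) (Q : nat) : 0 < s < 2 -> 0 <= delta ->
  \sum_(q < Q.+1) \sum_(b < (2 * Q).+1)
     (if (b <= 2 * q)%N then delta / q%:R else 0) `^ s <=
  3 * delta `^ s * (Q%:R + Q%:R `^ (2 - s)).
Proof.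
move=> /andP[s0 s2] d0.
have z0 : 0 `^ s = 0 :> R by rewrite powR0 ?gt_eqF.
rewrite big_ord_recl /= [X in X + _]big1 ?add0r; last first.
  by move=> b _; case: ifP => _; rewrite ?invr0 ?mulr0 z0.
have -> : 3 * delta `^ s * (Q%:R + Q%:R `^ (2 - s)) =
   \sum_(q < Q) 3 * delta `^ s * (1 + Q%:R `^ (1 - s)).
  rewrite sumr_const card_ord -mulr_natl.
  have -> : 2 - s = 1 + (1 - s) by ring.
  rewrite -(@mulr_powRB1 _ Q%:R (1 + (1 - s))) ?ler0n//; last lra.
  have -> : 1 + (1 - s) - 1 = 1 - s by ring.
  ring.
apply: ler_sum => q _; rewrite /bump /= add1n.
have q0 : 0 < q.+1%:R :> R by rewrite ltr0n.
have -> : \sum_(b < (2 * Q).+1)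
     (if (b <= 2 * q.+1)%N then delta / q.+1%:R else 0) `^ s =
  \sum_(b < (2 * q.+1).+1) (delta / q.+1%:R) `^ s.
  have hq : ((2 * q.+1).+1 <= (2 * Q).+1)%N by have := ltn_ord q; lia.
  rewrite (big_ord_widen _ (fun=> (delta / q.+1%:R) `^ s) hq) [RHS]big_mkcond.
  by apply: eq_bigr => b _; rewrite ltnS; case: ifP.
rewrite sumr_const card_ord -[leLHS]mulr_natl powRM ?invr_ge0//.
have -> : q.+1%:R^-1 `^ s = q.+1%:R `^ (- s) :> R.
  by rewrite -powR_inv1// -powRrM mulN1r.
have D0 : 0 <= delta `^ s by apply: powR_ge0.
have h1 : (2 * q.+1).+1%:R <= 3 * q.+1%:R :> R.
  by rewrite -natrM ler_nat; lia.
have h2 : q.+1%:R * q.+1%:R `^ (- s) = q.+1%:R `^ (1 - s) :> R.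
  by rewrite powRD ?powRr1//; apply/implyP => _; rewrite gt_eqF.
have h3 : q.+1%:R `^ (1 - s) <= 1 + Q%:R `^ (1 - s) :> R.
  have [s1|s1] := leP s 1.
    apply: (@le_trans _ _ (Q%:R `^ (1 - s))); last by rewrite lerDr.
    by apply: ge0_ler_powR; rewrite ?nnegrE ?ler_nat// subr_ge0.
  apply: (@le_trans _ _ 1); last by rewrite lerDl powR_ge0.
  rewrite -[leRHS](powRr0 q.+1%:R) ler_powR ?ler1n//; lra.
apply: (@le_trans _ _ (3 * q.+1%:R * (delta `^ s * q.+1%:R `^ (- s)))).
  by apply: ler_wpM2r h1; rewrite mulr_ge0// powR_ge0.
have -> : 3 * q.+1%:R * (delta `^ s * q.+1%:R `^ (- s)) =
  3 * delta `^ s * (q.+1%:R * q.+1%:R `^ (- s)) by ring.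
by rewrite h2 ler_wpM2l// mulr_ge0.
Qed.

(** With u = 2 - 2 alpha + eps and v = 2 alpha - 1 - eps, the scale X = 2^k costs
    X^(u - v s) + X^(u (2 - s) - v s).  As u + v = 1, the second exponent is
    2u - s = 4(1 - alpha) + 2 eps - s; the first is 2(1 - alpha) - (2 alpha - 1) s
    up to 3 eps, where 2 alpha - 1 >= 1/2.  So both are negative for small eps. *)
Lemma large_weyl_set_null alpha s :
  3 / 4 <= alpha -> alpha <= 1 -> 4 * (1 - alpha) < s -> s < 2 ->
  hausdorff_measure s (large_weyl_set alpha) = 0%E.
Proof.
move=> alo ahi slo s2.
have s0 : 0 < s by lra.
pose eps := (s - 4 * (1 - alpha)) / 8.
have e0 : 0 < eps by rewrite /eps; lra.
have e1 : eps <= 1 / 4 by rewrite /eps; lra.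
have sE : s = 8 * eps + 4 * (1 - alpha) by rewrite /eps; lra.
pose u := 2 - 2 * alpha + eps; pose v := 2 * alpha - 1 - eps.
have u0 : 0 < u by rewrite /u; lra.
have v0 : 0 < v by rewrite /v; lra.
have [D D0 [N0 hN0]] := @large_weyl_sum_near_rational R alpha eps ltac:(lra) ahi e0.
pose X k : R := 2 ^+ k.
have X0 k : 0 < X k by apply: exprn_gt0.
have X1 k : 1 <= X k by apply: exprn_ege1; lra.
pose dl k := D * X k `^ (- v).
have dl0 k : 0 <= dl k by rewrite mulr_ge0 ?(ltW D0) ?powR_ge0.
pose Q k := Num.truncn ((2 * X k) `^ u).
pose W k := (2 * Q k).+1.
(* The pair (q, b) is coded by the single index j = q W + b. *)
pose n k := ((Q k).+1 * W k)%N.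
pose G k j := [set x : R | [/\ (0 < j %/ W k)%N, (j %% W k <= 2 * (j %/ W k))%N &
   `|2 * (j %/ W k)%:R * x - (j %% W k)%:R| <= dl k]].
pose r k j := if (j %% W k <= 2 * (j %/ W k))%N then dl k / (j %/ W k)%:R else 0.
have r0 k j : 0 <= r k j by rewrite /r; case: ifP => _ //; rewrite divr_ge0.
have XR k w : X k `^ w = (2 `^ w) ^+ k.
  by rewrite -powR_mulrn ?powR_ge0// -powRrM mulrC powRrM powR_mulrn.
have dlim d : 0 < d -> exists k0 : nat, forall k, (k0 <= k)%N -> dl k <= d.
  move=> d0.
  have [M hM] := @powR_nat_large R (D / d) v v0.
  exists M => k Mk; rewrite /dl powRN ler_pdivrMr ?powR_gt0// mulrC -ler_pdivrMr//.
  rewrite (le_trans (hM k Mk))//; apply: ge0_ler_powR; rewrite ?nnegrE ?(ltW v0) ?(ltW (X0 k))//.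
  by rewrite /X -natrX ler_nat ltnW// ltn_expl.
pose C : R := 3 * D `^ s * 2 * 16.
apply: (@hausdorff_limsup_null _ _ s _ n G r C (2 `^ (- eps))).
- exact: ltW.
- by rewrite !mulr_ge0// powR_ge0.
- rewrite powR_ge0 /= powRN invf_lt1 ?powR_gt0//.
  have := @gt0_ltr_powR R eps e0 1 2; rewrite powR1; apply; rewrite ?nnegrE//; lra.
- move=> k j jn; apply: diameter_le => // x y [q1 bq hx] [_ _ hy].
  rewrite /r bq ler_pdivlMr ?ltr0n//.
  have qR : 0 < (j %/ W k)%:R :> R by rewrite ltr0n.
  rewrite -[X in _ * X <= _](gtr0_norm qR) -normrM.
  move: hx hy; set b := (j %% W k)%:R; set q := (j %/ W k)%:R.
  rewrite !ler_norml => /andP[? ?] /andP[? ?]; apply/andP; split; lra.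
- move=> d d0; have [k0 hk0] := dlim d d0; exists k0 => k j kk0 jn.
  rewrite /r; case: ifP => _; last exact: ltW.
  case: (posnP (j %/ W k)%N) => [->|q1]; first by rewrite invr0 mulr0 ltW.
  rewrite ler_pdivrMr ?ltr0n// (le_trans (hk0 k kk0))// ler_peMr ?ler1n//.
  exact: ltW.
- move=> k.
  rewrite (sum_ord_divmod (fun q b => (if (b <= 2 * q)%N then dl k / q%:R else 0) `^ s))//.
  rewrite (le_trans (near_rational_cost _ _ _))//; first by rewrite s0.
  have QX : (Q k)%:R <= (2 * X k) `^ u by rewrite truncn_le powR_ge0.
  have XX1 : 1 <= 2 * X k by have := X1 k; lra.
  have pw w w' : 0 <= w -> w <= 4 -> w - v * s <= w' ->
     X k `^ (- v * s) * (2 * X k) `^ w <= 16 * X k `^ w'.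
    move=> w0 w4 ww; rewrite powRM ?(ltW (X0 k))// mulrCA -powRD; last first.
      by apply/implyP => _; rewrite gt_eqF.
    apply: ler_pM; rewrite ?powR_ge0//; last by rewrite ler_powR//; lra.
    have -> : 16 = 2 `^ 4 :> R by rewrite powR_mulrn//; lra.
    by rewrite ler_powR//; lra.
  have p1 : X k `^ (- v * s) * (Q k)%:R <= 16 * X k `^ (- eps).
    apply: le_trans (pw u (- eps) _ _ _); rewrite ?ler_wpM2l ?powR_ge0 ?(ltW u0)//.
      by rewrite /u; lra.
    by rewrite /u /v; nra.
  have p2 : X k `^ (- v * s) * (Q k)%:R `^ (2 - s) <= 16 * X k `^ (- eps).
    apply: le_trans (pw (u * (2 - s)) (- eps) _ _ _).
    - rewrite (powRrM (2 * X k) u) ler_wpM2l ?powR_ge0// ge0_ler_powR ?nnegrE ?powR_ge0//; lra.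
    - by rewrite mulr_ge0 ?(ltW u0)//; lra.
    - rewrite /u; nra.
    - have -> : u * (2 - s) - v * s = 2 * u - s by rewrite /u /v; ring.
      rewrite /u; lra.
  rewrite /dl powRM ?(ltW D0) ?powR_ge0// -powRrM -XR /C.
  have : 0 <= 3 * D `^ s :> R by rewrite mulr_ge0// powR_ge0.
  move: (D `^ s) => E E0.
  have -> : 3 * (E * X k `^ (- v * s)) * ((Q k)%:R + (Q k)%:R `^ (2 - s)) =
   3 * E * (X k `^ (- v * s) * (Q k)%:R + X k `^ (- v * s) * (Q k)%:R `^ (2 - s)) by ring.
  have -> : 3 * E * 2 * 16 * X k `^ (- eps) =
    3 * E * (16 * X k `^ (- eps) + 16 * X k `^ (- eps)) by ring.
  by apply: ler_wpM2l => //; apply: lerD.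
- move=> x hx k0.
  have [k1 hk1] := dlim (1 / 2) ltac:(lra).
  pose K := maxn k0 k1; pose M := maxn (2 ^ K) N0.
  have M0 : (0 < M)%N by rewrite leq_max expn_gt0.
  have [/andP[x0 x1] [N [t [MN t0 hw]]]] := large_weyl_setP hx M0.
  move: MN; rewrite geq_max => /andP[KN N0N].
  have [q [b [q0 qle hb]]] := hN0 N x t N0N t0 hw.
  have NN : (0 < N)%N by apply: leq_trans KN; rewrite expn_gt0.
  pose k := trunc_log 2 N.
  have /andP[kl ku] : (2 ^ k <= N < 2 ^ k.+1)%N by apply: trunc_log_bounds.
  have Kk : (K <= k)%N by apply: trunc_log_max.
  have XN : X k <= N%:R by rewrite /X -natrX ler_nat.
  have NX : N%:R <= 2 * X k by rewrite -exprS -natrX ler_nat ltnW.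
  have NR : 0 < N%:R :> R by rewrite ltr0n.
  have hb2 : `|2 * q%:R * x - b%:~R| <= dl k.
    apply: (le_trans hb); rewrite ler_pM2l//.
    have -> : 1 - 2 * alpha + eps = - v by rewrite /v; ring.
    by rewrite !powRN lef_pV2 ?posrE ?powR_gt0//
      ge0_ler_powR ?nnegrE ?(ltW v0) ?(ltW (X0 k)) ?(ltW NR).
  have dlh : dl k <= 1 / 2 by apply: hk1; apply: leq_trans Kk; exact: leq_maxr.
  have qQ : (q <= Q k)%N.
    rewrite truncn_ge_nat ?powR_ge0//; apply: (le_trans qle).
    by apply: ge0_ler_powR; rewrite ?nnegrE ?(ltW u0) ?(ltW NR) ?mulr_ge0 ?(ltW (X0 k)).
  have qx0 : 0 <= 2 * q%:R * x by rewrite !mulr_ge0.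
  have qx1 : 2 * q%:R * x <= 2 * q%:R by rewrite ler_piMr// mulr_ge0.
  move: (hb2); rewrite ler_norml => /andP[hbl hbu].
  have [c c2q bc] : exists2 c : nat, (c <= 2 * q)%N & b = c.
    by apply: real_itv_int_le; rewrite ?natrM; lra.
  subst b; rename c into b; rename c2q into b2q.
  have bW : (b < W k)%N by rewrite /W ltnS (leq_trans b2q)// leq_mul2l qQ.
  exists k; split; first by apply: leq_trans Kk; exact: leq_maxl.
  exists (q * W k + b)%N; last first.
    by rewrite /G /= divnMDl// divn_small// addn0 modnMDl modn_small.
  apply: (@leq_trans (q * W k + W k)%N); first by rewrite ltn_add2l.
  by rewrite -mulSnr /n leq_mul2r ltnS qQ orbT.
Qed.

Lemma hausdorff_dim_large_weyl_set_le alpha :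
  3 / 4 <= alpha -> alpha <= 1 ->
  (hausdorff_dim (large_weyl_set alpha) <= (4 * (1 - alpha))%:E)%E.
Proof.
move=> alo ahi; apply/lee_addgt0Pr => e e0.
pose s := 4 * (1 - alpha) + Num.min e (1 / 2).
have m0 : 0 < Num.min e (1 / 2) by rewrite lt_min e0; lra.
have m1 : Num.min e (1 / 2) <= 1 / 2 by rewrite ge_min lexx orbT.
apply: (@le_trans _ _ s%:E).
  apply: ereal_inf_lbound; exists s => //; split; first by rewrite /s; lra.
  by apply: large_weyl_set_null => //; rewrite /s; lra.
by rewrite -EFinD lee_fin lerD2l ge_min lexx.
Qed.

End UpperBound.

(** * Gauss sums and Weyl sums near rationals *)

Section GaussSums.
Local Open Scope classical_set_scope.
Context {R : realType}.
Implicit Types (alpha x t : R) (b q k : nat).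

Lemma sum_shift_periodic (V : zmodType) (F : nat -> V) q h :
  (forall n, F (n + q)%N = F n) -> \sum_(r < q) F (r + h)%N = \sum_(r < q) F r.
Proof.
move=> Fq; elim: h => [|h IH]; first by apply: eq_bigr => r _; rewrite addn0.
rewrite -{}IH; case: q Fq => [|q] Fq; first by rewrite !big_ord0.
rewrite big_ord_recr big_ord_recl /= add0n addrC; congr (_ + _).
  by rewrite addnS addnC -addnS Fq.
by apply: eq_bigr => i _; rewrite /bump /= add1n addnS.
Qed.

Lemma sum_ord_le_const k (F : 'I_k -> R) c :
  (forall i, F i <= c) -> \sum_i F i <= k%:R * c.
Proof.
move=> h; rewrite mulr_natl -[k in X in _ <= X]card_ord -sumr_const.
by apply: ler_sum => i _; exact: h.
Qed.

(** A geometric sum over q-th roots of unity; since q is odd, 2h / q is not an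
    integer. *)
Lemma sum_roots_eq0 q h : odd q -> (0 < h < q)%N ->
  \sum_(r < q) phase (r%:R * (2 * h%:R / q%:R)) = 0 :> R[i].
Proof.
move=> oq /andP[h0 hq]; set z := 2 * _ / _.
have q0 : 0 < q%:R :> R by rewrite ltr0n; apply: leq_ltn_trans hq.
have [b hb] := phase_sub1_ge z.
have z1 : phase z - 1 != 0.
  apply/eqP => e; move: hb; rewrite e ComplexField.Normc.normc0 mulr0 normr_le0.
  rewrite subr_eq0 /z => /eqP /(congr1 (fun v => v * q%:R)).
  rewrite divfK ?gt_eqF// => e2.
  have e3 : (2 * h)%N%:Z = b * q%:Z.
    by apply/eqP; rewrite -(eqr_int R) rmorphM /= -[X in X == _]/((2 * h)%N%:R) natrM e2.
  have : (q %| 2 * h)%N.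
    have : (q%:Z %| (2 * h)%N%:Z)%Z by rewrite e3 dvdz_mull.
    by rewrite dvdzE.
  rewrite Gauss_dvdr ?coprimen2// => /(dvdn_leq h0).
  by rewrite leqNgt hq.
apply: (mulfI z1); rewrite mulr0 mulrC mulr_suml.
rewrite (eq_bigr (fun r : 'I_q => phase (r.+1%:R * z) - phase (r%:R * z))).
  rewrite -(big_mkord xpredT (fun r => phase (r.+1%:R * z) - phase (r%:R * z))).
  rewrite telescope_sumr// mul0r phase0.
  have -> : q%:R * z = (2 * h)%:R by rewrite natrM /z mulrC divfK ?gt_eqF.
  by rewrite phase_nat subrr.
by move=> r _; rewrite mulrBr mulr1 -phaseD -natr1; congr (phase _ - _); ring.
Qed.

Definition gauss_term b q n : R[i] :=
  phase (n.+1%:R * (b%:R / q%:R) + n.+1%:R ^+ 2 * q%:R^-1).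

Lemma gauss_term_periodic b q n : (0 < q)%N ->
  gauss_term b q (n + q) = gauss_term b q n.
Proof.
move=> q0; have qR : q%:R != 0 :> R by rewrite pnatr_eq0 -lt0n.
rewrite /gauss_term -[RHS](phaseDnat _ (b + 2 * n.+1 + q)); congr phase.
by rewrite -addSn !natrD natrM; field.
Qed.

(** In |G|^2 the sum over r for a fixed difference h is a sum of q-th roots of
    unity, and vanishes unless h = 0. *)
Lemma gauss_sum_sqr b q : odd q -> cabs (\sum_(r < q) gauss_term b q r) ^+ 2 = q%:R.
Proof.
move=> oq; have q0 : (0 < q)%N by exact: odd_gt0.
have qR : q%:R != 0 :> R by rewrite pnatr_eq0 -lt0n.
set G := \sum_(_ < _) _.
have -> : cabs G ^+ 2 = cabs (G * G^*%C) by rewrite cabsM cabs_conj expr2.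
suff -> : G * G^*%C = q%:R by rewrite cabs_nat.
rewrite {2}/G conjc_sum mulr_sumr.
have step r : G * (gauss_term b q r)^*%C = \sum_(h < q)
    phase (h%:R * (b%:R / q%:R) + h%:R ^+ 2 * q%:R^-1 + 2 * h%:R / q%:R) *
    phase (r%:R * (2 * h%:R / q%:R)).
  rewrite /G -(@sum_shift_periodic _ (gauss_term b q) q r) => [|n]; last first.
    exact: gauss_term_periodic.
  rewrite mulr_suml; apply: eq_bigr => h _.
  rewrite phaseB -phaseD; congr phase.
  by rewrite -addnS natrD -[r.+1%:R]natr1; field.
under eq_bigr do rewrite step.
rewrite exchange_big /=.
under eq_bigr do rewrite -mulr_sumr.
case: q oq q0 qR @G step => // q oq _ qR G step.
rewrite big_ord_recl /= [X in _ + X]big1 ?addr0.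
  rewrite !(mulr0n, mul0r, mulr0, expr0n, addr0) /= ?(mul0r, addr0) phase0 mul1r.
  under eq_bigr do rewrite mulr0 phase0.
  by rewrite sumr_const card_ord.
move=> h _; rewrite sum_roots_eq0 ?mulr0//.
by rewrite /bump /= add1n ltnS.
Qed.

(** On each of the k blocks of length q the factor e((jq + r) gam) is replaced by
    e(jq gam).  What is left is the Gauss sum times a sum of k numbers close to 1;
    the replacement costs k q * 8 q |gam|, which is at most k / 4 as q <= k. *)
Lemma weyl_sum_near_rational_ge b q k x : odd q -> (q <= k)%N ->
  `|x - b%:R / q%:R| * (32 * (k * q)%:R) <= 1 ->
  k%:R * Num.sqrt q%:R / 2 <= cabs (weyl_sum (k * q) x q%:R^-1).
Proof.
move=> oq qk; set gam := x - _ => hg.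
have q0 : (0 < q)%N by exact: odd_gt0.
have qR : 0 < q%:R :> R by rewrite ltr0n.
have q1 : 1 <= q%:R :> R by rewrite ler1n.
have kR : 0 < k%:R :> R by rewrite ltr0n; exact: leq_trans qk.
set G := \sum_(r < q) gauss_term b q r.
have cG : cabs G = Num.sqrt q%:R.
  by rewrite -(gauss_sum_sqr b oq) sqrtr_sqr ger0_norm ?cabs_ge0.
have g0 := normr_ge0 gam.
have -> : weyl_sum (k * q) x q%:R^-1 =
   \sum_(j < k) \sum_(r < q) gauss_term b q r * phase ((j * q + r).+1%:R * gam).
  rewrite weyl_sumE.
  elim: k {qk hg kR} => [|k IH]; first by rewrite !big_ord0.
  rewrite mulSnr big_split_ord /= IH big_ord_recr /=; congr (_ + _).
  apply: eq_bigr => r _.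
  have -> : gauss_term b q r = gauss_term b q (k * q + r).
    elim: (k) => [|l IHl]; first by rewrite add0n.
    by rewrite IHl mulSnr addnAC gauss_term_periodic.
  by rewrite /gauss_term -phaseD; congr phase; rewrite /gam; field; rewrite gt_eqF.
clearbody gam; set S := \sum_(j < k) _.
pose T : R[i] := \sum_(j < k) phase (j%:R * (q%:R * gam)).
have hST : cabs (S - G * T) <= (k * q)%:R * (8 * q%:R * `|gam|).
  rewrite /S /T mulr_sumr -sumrB (le_trans (cabs_sum _ _ _))//.
  rewrite natrM -[leRHS]mulrA; apply: sum_ord_le_const => j; rewrite mulr_suml
    -sumrB (le_trans (cabs_sum _ _ _))//.
  apply: sum_ord_le_const => r.
  have -> : gauss_term b q r * phase ((j * q + r).+1%:R * gam) -
     gauss_term b q r * phase (j%:R * (q%:R * gam)) =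
     gauss_term b q r * phase (j%:R * (q%:R * gam)) * (phase (r.+1%:R * gam) - 1).
    have -> : (j * q + r).+1%:R * gam = j%:R * (q%:R * gam) + r.+1%:R * gam.
      by rewrite -addnS natrD natrM; ring.
    by rewrite phaseD; ring.
  rewrite !cabsM !cabs_phase !mul1r (le_trans (phase_sub1_le _))//.
  rewrite normrM ger0_norm// mulrA ler_wpM2r// ler_pM2l// ler_nat.
  exact: ltn_ord.
have hT : k%:R - k%:R * (8 * (k * q)%:R * `|gam|) <= cabs T.
  rewrite lerBlDr -lerBlDl.
  apply: (@le_trans _ _ (cabs (k%:R - T))).
    rewrite lerBlDr -{1}(cabs_nat k) -{1}[k%:R](subrK T); exact: cabsD.
  have -> : k%:R - T = \sum_(j < k) (1 - phase (j%:R * (q%:R * gam))).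
    by rewrite sumrB sumr_const card_ord.
  rewrite (le_trans (cabs_sum _ _ _))//.
  apply: sum_ord_le_const => j.
  rewrite cabs_distC (le_trans (phase_sub1_le _))// mulrA normrM ger0_norm ?mulr_ge0//.
  rewrite mulrA ler_wpM2r// ler_pM2l// -natrM ler_nat leq_mul2r.
  by rewrite (ltnW (ltn_ord j)) orbT.
have hS : cabs G * cabs T <= cabs S + cabs (S - G * T).
  have e : G * T = S - (S - G * T) by ring.
  by rewrite -cabsM {1}e cabsB.
have sq1 : 1 <= Num.sqrt q%:R :> R by rewrite -[leLHS]sqrtr1 ler_sqrt.
rewrite cG in hS.
move: hg hT hST hS; set sq := Num.sqrt _ in sq1 *.
have qk' : q%:R <= k%:R :> R by rewrite ler_nat.
rewrite natrM => hg hT hST hS.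
have h1 : 8 * (k%:R * q%:R) * `|gam| <= 1 / 4 by lra.
have h2 : k%:R * (3 / 4) <= cabs T.
  apply: le_trans hT; have := ler_wpM2l (ltW kR) h1; lra.
have h3 : k%:R * q%:R * (8 * q%:R * `|gam|) <= k%:R / 4.
  have -> : k%:R * q%:R * (8 * q%:R * `|gam|) = q%:R * (8 * (k%:R * q%:R) * `|gam|) by ring.
  have := ler_wpM2l (ltW qR) h1; lra.
have h4 : sq * (k%:R * (3 / 4)) <= sq * cabs T by apply: ler_wpM2l => //; lra.
have h5 : k%:R <= k%:R * sq by apply: ler_peMr => //; exact: ltW.
lra.
Qed.

(** The sum is taken up to N = k q, close to q^tau / 32, at t = 1 / q.  It has size
    k sqrt q / 2, of order q^(tau - 1/2), and this exceeds N^alpha because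
    tau - 1/2 > tau alpha. *)
Lemma weyl_sup_near_rational alpha tau : 0 <= alpha -> alpha < 1 -> 2 < tau ->
  1 < 2 * tau * (1 - alpha) ->
  exists q0 : nat, forall q b x, (q0 <= q)%N -> odd q ->
    `|x - b%:R / q%:R| <= q%:R `^ (- tau) ->
    exists N, (q <= N)%N /\ ((N%:R `^ alpha)%:E <= weyl_sup N x)%E.
Proof.
move=> a0 a1 tau2 tala.
have [n1 h1] := @powR_nat_large R 64 (tau - 2) ltac:(lra).
pose e := tau * (1 - alpha) - 1 / 2.
have e0 : 0 < e by rewrite /e; lra.
have [n2 h2] := @powR_nat_large R 128 e e0.
exists (maxn 2 (maxn n1 n2)) => q b x; rewrite !geq_max => /and3P[q2 /h1 hq1 /h2 hq2] oq hx.
have q0 : (0 < q)%N by exact: odd_gt0.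
have qR : 0 < q%:R :> R by rewrite ltr0n.
have q1 : 1 <= q%:R :> R by rewrite ler1n.
have qD r s : q%:R `^ (r + s) = q%:R `^ r * q%:R `^ s :> R.
  by rewrite powRD//; apply/implyP => _; rewrite gt_eqF.
set P := q%:R `^ (tau - 1).
have P64 : 64 * q%:R <= P.
  rewrite /P (_ : tau - 1 = (tau - 2) + 1); last by ring.
  by rewrite qD powRr1 ?(ltW qR)// ler_pM2r.
have P0 : 0 <= P by exact: powR_ge0.
pose k := Num.truncn (P / 32).
have k1 : k%:R <= P / 32 by rewrite truncn_le; lra.
have k2 : P / 64 <= k%:R.
  have := truncnS_gt (P / 32); rewrite -/k -[k.+1%:R]natr1; lra.
have qk : (q <= k)%N by rewrite -(ler_nat R); lra.
have Pq : P * q%:R = q%:R `^ tau.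
  by rewrite /P -[X in _ * X = _]powRr1 ?(ltW qR)// -qD subrK.
exists (k * q)%N; split; first by rewrite leq_pmull// (leq_trans q0).
have kR : 0 < k%:R :> R by rewrite ltr0n (leq_trans q0).
have hw : k%:R * Num.sqrt q%:R / 2 <= cabs (weyl_sum (k * q) x q%:R^-1).
  apply: (@weyl_sum_near_rational_ge b) => //.
  have kq0 : 0 <= (k * q)%:R :> R by [].
  apply: (@le_trans _ _ (q%:R `^ (- tau) * (32 * (k * q)%:R))).
    by apply: ler_wpM2r hx; lra.
  rewrite powRN mulrC ler_pdivrMr ?powR_gt0// mul1r natrM mulrA -Pq ler_wpM2r ?(ltW qR)//; lra.
apply: (@le_trans _ _ (cabs (weyl_sum (k * q) x q%:R^-1))%:E); last first.
  apply: ereal_sup_ubound; exists q%:R^-1 => //=.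
  by rewrite in_itv /= invr_gt0 qR invf_lt1// ltr1n.
rewrite lee_fin; apply: le_trans hw.
rewrite natrM powRM ?(ltW kR) ?(ltW qR)//.
rewrite -powR12_sqrt ?(ltW qR)//.
have kD : k%:R = k%:R `^ alpha * k%:R `^ (1 - alpha) :> R.
  rewrite -powRD; last by apply/implyP => _; rewrite gt_eqF.
  by rewrite addrC subrK powRr1 ?(ltW kR).
rewrite [X in _ <= X * _ / _]kD -!mulrA ler_wpM2l ?powR_ge0//.
have kP : q%:R `^ ((tau - 1) * (1 - alpha)) / 64 <= k%:R `^ (1 - alpha).
  rewrite powRrM -/P.
  apply: (@le_trans _ _ ((P / 64) `^ (1 - alpha))).
    rewrite powRM//.
    rewrite ler_wpM2l ?powR_ge0//.
    by apply: ger1_powR; [apply/andP; split; lra|lra].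
  by apply: ge0_ler_powR; rewrite ?nnegrE; lra.
have s0 : 0 <= q%:R `^ (2^-1) / 2 :> R by rewrite divr_ge0 ?powR_ge0.
apply: le_trans (ler_wpM2r s0 kP).
have -> : q%:R `^ ((tau - 1) * (1 - alpha)) / 64 * (q%:R `^ 2^-1 / 2) =
   q%:R `^ ((tau - 1) * (1 - alpha)) * q%:R `^ 2^-1 / 128 :> R by field.
rewrite -qD.
have -> : (tau - 1) * (1 - alpha) + 2^-1 = alpha + e by rewrite /e; field.
rewrite qD ler_pdivlMr; last by lra.
by rewrite ler_wpM2l ?powR_ge0.
Qed.

Lemma infinite_nat_of_ge (A : set nat) :
  (forall M, exists2 N, (M <= N)%N & A N) -> infinite_set A.
Proof.
move=> h /finite_fsetP[X XA].
have [N] := h (\max_(i <- finmap.enum_fset X) i).+1; rewrite XA /= => hN NX.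
by move: hN; rewrite ltnNge leq_bigmax_seq.
Qed.

Lemma large_weyl_set_of_approximable alpha tau x :
  0 <= alpha -> alpha < 1 -> 2 < tau -> 1 < 2 * tau * (1 - alpha) -> 0 <= x <= 1 ->
  (forall M : nat, exists q b : nat, [/\ (M <= q)%N, odd q &
     `|x - b%:R / q%:R| <= q%:R `^ (- tau)]) ->
  large_weyl_set alpha x.
Proof.
move=> a0 a1 tau2 tala x01 hx; split; first by rewrite /= in_itv.
have [q0 h0] := weyl_sup_near_rational a0 a1 tau2 tala.
apply: infinite_nat_of_ge => M.
have [q [b [+ oq hq]]] := hx (maxn M q0).
rewrite geq_max => /andP[Mq q0q].
have [N [qN hN]] := h0 q b x q0q oq hq.
by exists N => //; exact: leq_trans qN.
Qed.

End GaussSums.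

(** * Separated fractions with odd denominators *)

Section Packing.
Context {R : realType}.

(** Cutting the range of g into cells of length delta, starting at its minimum,
    puts at most one point of A in each cell. *)
Lemma card_separated_le (T : finType) (A : {set T}) (g : T -> R) (delta lam : R) :
  0 < delta -> 0 <= lam ->
  (forall i j, i \in A -> j \in A -> `|g i - g j| <= lam) ->
  (forall i j, i \in A -> j \in A -> i != j -> delta <= `|g i - g j|) ->
  #|A|%:R <= lam / delta + 1.
Proof.
move=> d0 l0 diamA sepA.
have ld0 : 0 <= lam / delta by rewrite divr_ge0// ltW.
have [->|/set0Pn[i0 i0A]] := eqVneq A finset.set0; first by rewrite cards0 addr_ge0.
have [i1 i1A mini] := arg_minP g i0A.
pose f i := Num.truncn ((g i - g i1) / delta).
have f0 i : i \in A -> 0 <= (g i - g i1) / delta.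
  by move=> iA; rewrite divr_ge0 ?(ltW d0)// subr_ge0 mini.
have fle i : i \in A -> (f i < (Num.truncn (lam / delta)).+1)%N.
  move=> iA; rewrite ltnS; apply: le_truncn; rewrite ler_pM2r ?invr_gt0//.
  exact: le_trans (ler_norm _) (diamA _ _ _ _).
have finj : {in A &, injective (fun i => inord (f i) : 'I_(Num.truncn (lam / delta)).+1)}.
  move=> i j iA jA /(congr1 val); rewrite /= !inordK ?fle// => fij.
  apply/eqP; apply: contraT => ij; have := sepA i j iA jA ij.
  have /andP[hi1 hi2] := truncn_itv (f0 i iA).
  have /andP[hj1 hj2] := truncn_itv (f0 j jA).
  rewrite -/(f i) -/(f j) fij -natr1 in hi1 hi2 hj1 hj2 *.
  have : `|(g i - g i1) / delta - (g j - g i1) / delta| < 1.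
    by rewrite ltr_norml; apply/andP; split; lra.
  rewrite -mulrBl normrM [X in _ * X]gtr0_norm ?invr_gt0// ltr_pdivrMr// mul1r.
  by rewrite (_ : g i - g i1 - (g j - g i1) = g i - g j) ?leNgt => [->|]; last ring.
have : (#|A| <= (Num.truncn (lam / delta)).+1)%N.
  rewrite -(card_in_imset finj) -[leqRHS]card_ord.
  exact: max_card.
rewrite -(ler_nat R) => /le_trans; apply.
by rewrite -natr1 lerD2r truncn_le.
Qed.

Lemma card_nat_itv_ge (P : nat -> bool) (n : nat) (a lam : R) :
  0 <= a -> 0 <= lam -> a + lam < n%:R ->
  (forall b : nat, a <= b%:R <= a + lam -> P b) ->
  lam - 1 <= #|[set b : 'I_n | P b]|%:R.
Proof.
move=> a0 l0 an hP; set k := Num.truncn lam.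
have /andP[kl ku] : k%:R <= lam < k.+1%:R by apply: truncn_itv.
have /andP[ul uu] : (Num.truncn a)%:R <= a < (Num.truncn a).+1%:R by apply: truncn_itv.
set u := (Num.truncn a).+1 in uu.
have bd (i : 'I_k) : a <= (u + i)%:R <= a + lam.
  rewrite natrD; have : i.+1%:R <= k%:R :> R by rewrite ler_nat.
  rewrite -[i.+1%:R]natr1 => hi.
  have i0 : 0 <= i%:R :> R by [].
  have uE : u%:R = (Num.truncn a)%:R + 1 :> R by rewrite natr1.
  by apply/andP; split; lra.
have bn (i : 'I_k) : (u + i < n)%N.
  by rewrite -(ltr_nat R); apply: le_lt_trans an; case/andP: (bd i).
pose f (i : 'I_k) : 'I_n := Ordinal (bn i).
have finj : injective f by move=> i j /(congr1 val)/= /addnI/val_inj.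
have : (k <= #|[set b : 'I_n | P b]|)%N.
  rewrite -[k in leqLHS]card_ord -cardsT -(card_imset _ finj).
  apply: subset_leq_card; apply/fintype.subsetP => _ /imsetP[i _ ->].
  by rewrite inE /= hP.
by rewrite -(ler_nat R); apply: le_trans; rewrite -natr1 in ku; lra.
Qed.

End Packing.

Lemma eq_mod_of_dvd_sub_double d n x y : odd d -> (2 * x <= n)%N -> (2 * y <= n)%N ->
  (d %| n - 2 * x)%N -> (d %| n - 2 * y)%N -> x = y %[mod d].
Proof.
move=> od; wlog xy : x y / (y <= x)%N => [h|] hx hy dx dy.
  by case/orP: (leq_total x y) => le; [apply/esym|]; exact: h.
apply/eqP; rewrite eqn_mod_dvd//.
rewrite -(@Gauss_dvdr d 2) ?coprimen2//.
have -> : (2 * (x - y) = (n - 2 * y) - (n - 2 * x))%N by lia.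
exact: dvdn_sub.
Qed.

(** The denominators n - 2l, l < L, are odd when n is, and the choice of a window
    much shorter than n keeps repeated fractions rare: two distinct denominators
    have no common divisor above 2L. *)
Section Denominators.
Variables (n L : nat).

Definition den (l : nat) := (n - 2 * l)%N.

Definition reduced_den (p : 'I_L * 'I_n) := (den p.1 %/ gcdn p.2 (den p.1))%N.

Lemma den_le l : (den l <= n)%N.
Proof. exact: leq_subr. Qed.

Hypothesis Ln : (2 * L < n)%N.

Lemma lt_double (l : 'I_L) : (2 * l < n)%N.
Proof. by rewrite (leq_ltn_trans _ Ln)// leq_mul2l ltnW. Qed.

Lemma den_gt0 (l : 'I_L) : (0 < den l)%N.
Proof. by rewrite subn_gt0 lt_double. Qed.

Lemma den_odd (l : 'I_L) : odd n -> odd (den l).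
Proof. by move=> n_odd; rewrite oddB ?n_odd ?oddM// ltnW// lt_double. Qed.

Lemma den_diff_dvd (l m : 'I_L) d : l != m -> (d %| den l)%N -> (d %| den m)%N ->
  (d <= 2 * L)%N.
Proof.
wlog lm : l m / (l < m)%N => [h lm dl dm|].
  have := lm; rewrite -val_eqE /= neq_ltn => /orP[h1|h1]; first exact: (h l m).
  by apply: (h m l) => //; rewrite eq_sym.
move=> _ dl dm; have : (d %| den l - den m)%N by apply: dvdn_sub.
have -> : (den l - den m = 2 * (m - l))%N.
  by rewrite /den; have := lt_double m; lia.
move=> /dvdn_leq h; apply: leq_trans (h _) _; have := ltn_ord m; lia.
Qed.

End Denominators.

Section Farey.
Context {R : realType}.
Variables (n L : nat) (c rho : R).

Local Notation den := (den n).

Definition pair_frac (p : 'I_L * 'I_n) : R := p.2%:R / (den p.1)%:R.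

Definition near_pairs := [set p : 'I_L * 'I_n | `|pair_frac p - c| <= rho / 2].

(** Discarding the small reduced denominators makes pair_frac injective. *)
Definition farey := [set p in near_pairs | (2 * L < reduced_den p)%N].

Hypothesis Ln : (2 * L < n)%N.

Let denR (l : 'I_L) : 0 < (den l)%:R :> R. Proof. by rewrite ltr0n (den_gt0 Ln). Qed.

Let denN0 (l : 'I_L) : (den l)%:R != 0 :> R. Proof. by rewrite gt_eqF. Qed.

Lemma pair_frac_eq_reduced_dvd p p' : pair_frac p = pair_frac p' -> (reduced_den p %| den p'.1)%N.
Proof.
move=> /eqP; rewrite /pair_frac eqr_div// -!natrM eqr_nat => /eqP h.
rewrite /reduced_den; set g := gcdn _ _.
have g0 : (0 < g)%N by rewrite gcdn_gt0 (den_gt0 Ln) orbT.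
have cop : coprime (den p.1 %/ g) (p.2 %/ g).
  by rewrite /coprime -(eqn_pmul2r g0) mul1n muln_gcdl !divnK ?dvdn_gcdl ?dvdn_gcdr// gcdnC.
rewrite -(Gauss_dvdr _ cop); apply/dvdnP; exists p'.2.
apply/eqP; rewrite -(eqn_pmul2r g0) mulnAC divnK ?dvdn_gcdl// h.
by rewrite -mulnA divnK ?dvdn_gcdr.
Qed.

(** If two pairs gave the same fraction, its reduced denominator would divide both
    denominators, hence their difference, and be at most 2L. *)
Lemma farey_separated p p' : p \in farey -> p' \in farey -> p != p' ->
  (n%:R ^+ 2)^-1 <= `|pair_frac p - pair_frac p'|.
Proof.
rewrite !inE => /andP[_ hp] /andP[_ hp'] pp'.
have ne : pair_frac p != pair_frac p'.
  apply/eqP => e; move: hp; rewrite ltnNge => /negP; apply.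
  have [el|ll'] := eqVneq p.1 p'.1; last first.
    apply: (den_diff_dvd Ln ll'); last exact: pair_frac_eq_reduced_dvd.
    by rewrite /reduced_den dvdn_div ?dvdn_gcdr.
  case/negP: pp'; apply/eqP; move: e; rewrite /pair_frac el => /(mulIf _) h.
  have /eqP : p.2%:R = p'.2%:R :> R by apply: h; rewrite invr_eq0.
  rewrite eqr_nat => /eqP/val_inj.
  by case: p p' {hp' h} el => [? ?] [? ?] /= -> ->.
have -> : pair_frac p - pair_frac p' =
    (p.2%:Z * (den p'.1)%:Z - p'.2%:Z * (den p.1)%:Z)%:~R / ((den p.1)%:R * (den p'.1)%:R).
  by rewrite rmorphB !rmorphM /= /pair_frac; field; rewrite !denN0.
rewrite normrM normfV [X in _ / X]gtr0_norm ?mulr_gt0//.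
have z1 : 1 <= `|(p.2%:Z * (den p'.1)%:Z - p'.2%:Z * (den p.1)%:Z)%:~R : R|.
  rewrite -intr_norm -[1]/(1%:~R) ler_int -gtz0_ge1 normr_gt0.
  apply: contra ne => /eqP/(congr1 (fun z : int => z%:~R : R)) e.
  rewrite /pair_frac eqr_div//; apply/eqP.
  by move: e; rewrite rmorphB !rmorphM /= => /eqP; rewrite subr_eq0 => /eqP.
have n0 : 0 < n%:R :> R by rewrite ltr0n; lia.
rewrite -[leLHS]mul1r; apply: ler_pM => //.
rewrite lef_pV2 ?posrE ?exprn_gt0 ?mulr_gt0// expr2.
by apply: ler_pM; rewrite ?ler_nat ?den_le.
Qed.

Hypotheses (rho0 : 0 < rho) (c0 : 0 <= c - rho) (c1 : c + rho <= 1).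

Lemma card_near_pairs_ge : L%:R * ((n - 2 * L)%:R * rho - 1) <= #|near_pairs|%:R.
Proof.
have [r0' [c0' c1']] := (rho0, (c0, c1)).
have -> : #|near_pairs| =
    (\sum_(l < L) #|[set b : 'I_n | (`|b%:R / (den l)%:R - c| <= rho / 2)%R]|)%N.
  rewrite -sum1_card.
  under [RHS]eq_bigr => l _ do rewrite -sum1_card.
  by rewrite pair_big_dep /=; apply: eq_bigl => -[l b]; rewrite !inE /pair_frac.
rewrite natr_sum mulr_natl -[X in _ *+ X]card_ord -sumr_const.
apply: ler_sum => l _.
have qn : (n - 2 * L)%:R <= (den l)%:R :> R.
  by rewrite ler_nat /den; have := ltn_ord l; lia.
have q0 := denR l.
apply: (@le_trans _ _ ((den l)%:R * rho - 1)).
  by rewrite lerD2r ler_pM2r.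
apply: (@card_nat_itv_ge _ (fun b => `|b%:R / (den l)%:R - c| <= rho / 2) n
  ((den l)%:R * (c - rho / 2))).
- by rewrite mulr_ge0 ?(ltW q0)//; lra.
- by rewrite mulr_ge0 ?(ltW q0)//; lra.
- have -> : (den l)%:R * (c - rho / 2) + (den l)%:R * rho = (den l)%:R * (c + rho / 2).
    by field.
  apply: (@lt_le_trans _ _ (den l)%:R); last by rewrite ler_nat den_le.
  by rewrite gtr_pMr//; lra.
move=> b /andP[hb1 hb2].
have hb : (den l)%:R * (b%:R / (den l)%:R) = b%:R :> R by rewrite mulrC divfK.
rewrite ler_norml; apply/andP; split.
  by rewrite -(ler_pM2l q0) mulrBr hb; lra.
by rewrite -(ler_pM2l q0) mulrBr hb; lra.
Qed.

Hypotheses (n_odd : odd n) (L0 : (0 < L)%N).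

(** A bad pair (l, b) with reduced fraction b0 / m is encoded by m and
    b0 + m * (l %/ m).  The residue of l modulo m is determined by m, because the
    odd number m divides n - 2l; so the code determines l, and then b.  It ranges
    over at most (2L + 1) * 3L values. *)
Lemma card_small_reduced_den_le :
  (#|[set p in near_pairs | (reduced_den p <= 2 * L)%N]| <= 9 * L ^ 2)%N.
Proof.
have [r0' [c0' c1']] := (rho0, (c0, c1)).
set A := [set p in _ | _].
pose g (p : 'I_L * 'I_n) := gcdn p.2 (den p.1).
have g0 p : (0 < g p)%N by rewrite gcdn_gt0 (den_gt0 Ln) orbT.
pose b0 (p : 'I_L * 'I_n) := (p.2 %/ g p)%N.
have dE p : (reduced_den p * g p = den p.1)%N by rewrite divnK// dvdn_gcdr.
have bE p : (b0 p * g p = p.2)%N by rewrite divnK// dvdn_gcdl.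
have r0 (p : 'I_L * 'I_n) : (0 < reduced_den p)%N.
  have := den_gt0 Ln p.1; rewrite -(dE p) muln_gt0 => /andP[] //.
have bq p : p \in A -> (b0 p < reduced_den p)%N.
  rewrite !inE => /andP[hp _].
  have : p.2%:R / (den p.1)%:R < 1 :> R.
    move: hp; rewrite ler_norml /pair_frac => /andP[_ ?]; lra.
  rewrite ltr_pdivrMr// mul1r ltr_nat -[X in (X < _)%N](bE p) -[X in (_ < X)%N](dE p).
  by rewrite ltn_pmul2r.
pose code (p : 'I_L * 'I_n) := (b0 p + reduced_den p * (p.1 %/ reduced_den p))%N.
have code_lt p : p \in A -> (code p < 3 * L)%N.
  move=> pA; have h1 := bq p pA; have h2 := leq_trunc_div p.1 (reduced_den p).
  move: pA; rewrite !inE => /andP[_ h3].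
  rewrite mulnC in h2; have := ltn_ord p.1; rewrite /code; lia.
pose f (p : 'I_L * 'I_n) : 'I_(2 * L).+1 * 'I_(3 * L).-1.+1 :=
  (inord (reduced_den p), inord (code p)).
have L3 : (3 * L).-1.+1 = (3 * L)%N by rewrite prednK// muln_gt0.
have finj : {in A &, injective f}.
  move=> p p' pA p'A [] /(congr1 val) /= + /(congr1 val) /=.
  rewrite !inordK ?L3 ?code_lt//;
    try by [move: pA p'A; rewrite !inE => /andP[_ +] /andP[_ +]; rewrite ltnS].
  move=> er ec.
  have h1 := bq p pA; have h2 := bq p' p'A.
  have eb : b0 p = b0 p'.
    have : (code p %% reduced_den p = code p' %% reduced_den p')%N by rewrite ec er.
    by rewrite /code !(addnC (b0 _)) !(mulnC (reduced_den _)) !modnMDl !modn_small.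
  have ej : (p.1 %/ reduced_den p = p'.1 %/ reduced_den p)%N.
    apply/eqP; rewrite -(eqn_pmul2l (r0 p)) -(eqn_add2l (b0 p)); apply/eqP.
    by move: ec; rewrite /code -er -eb.
  have rodd : odd (reduced_den p).
    by have := den_odd Ln p.1 n_odd; rewrite -(dE p) oddM => /andP[].
  have dvd1 : (reduced_den p %| den p.1)%N by apply/dvdnP; exists (g p); rewrite mulnC dE.
  have dvd2 : (reduced_den p %| den p'.1)%N by apply/dvdnP; exists (g p'); rewrite mulnC er dE.
  have em : (p.1 %% reduced_den p = p'.1 %% reduced_den p)%N.
    by apply: (eq_mod_of_dvd_sub_double rodd _ _ dvd1 dvd2); rewrite ltnW ?(lt_double Ln).
  have el : p.1 = p'.1.
    by apply: val_inj; rewrite /= (divn_eq p.1 (reduced_den p)) ej em -divn_eq.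
  have eg : g p = g p'.
    apply/eqP; rewrite -(eqn_pmul2l (r0 p)) dE er dE el//.
  have e2 : p.2 = p'.2 by apply: val_inj; rewrite /= -bE eb eg bE.
  by move: el e2; case: (p) (p') => [? ?] [? ?] /= -> ->.
have : (#|A| <= (2 * L).+1 * (3 * L))%N.
  rewrite -(card_in_imset finj) (leq_trans (max_card _))//.
  by rewrite card_prod !card_ord L3.
move=> /leq_trans; apply; nia.
Qed.

Lemma card_farey_ge :
  L%:R * ((n - 2 * L)%:R * rho - 1) - 9 * L%:R ^+ 2 <= #|farey|%:R.
Proof.
set A := [set p in near_pairs | (reduced_den p <= 2 * L)%N].
have : (#|near_pairs| <= #|farey| + #|A|)%N.
  rewrite -cardsUI -[leqLHS]addn0 leq_add//; apply: subset_leq_card.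
  by apply/fintype.subsetP => p; rewrite !inE => ->; case: ltnP.
rewrite -(ler_nat R) natrD.
have := card_near_pairs_ge.
have : #|A|%:R <= 9 * L%:R ^+ 2 :> R.
  by rewrite -natrX -natrM ler_nat; exact: card_small_reduced_den_le.
lra.
Qed.

End Farey.

(** * Choosing a lightly covered child interval *)

Section Selection.
Context {R : realType}.

(** If every p were heavy, the weights min(1, v_i / theta) of the indices hitting
    p would add up to at least 1: either a single index is heavy by itself, or no
    weight is truncated.  Summing over p contradicts the hypothesis.  The
    truncation serves to charge an index of large v_i only once per point. *)
Lemma exists_light_point (T : finType) (A : {set T}) (hit : nat -> T -> bool)
    (v : nat -> R) (theta : R) : 0 < theta -> (forall i, 0 <= v i) ->
  (forall K, \sum_(i < K) Num.min 1 (v i / theta) * #|[set p in A | hit i p]|%:R < #|A|%:R) ->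
  exists2 p, p \in A & forall K, \sum_(i < K | hit i p) v i <= theta.
Proof.
move=> th0 v0 hlt; apply: contrapT => hno.
have hbad p : exists K, p \in A -> theta < \sum_(i < K | hit i p) v i.
  have [pA|pA] := boolP (p \in A); last by exists 0%N.
  apply: contrapT => /forallNP h; apply: hno; exists p => // K.
  by rewrite leNgt; apply/negP => lt; apply: (h K) => _.
have [Kf hKf] := choice hbad.
pose K := (\max_p Kf p)%N.
have {}hKf p : p \in A -> theta < \sum_(i < K | hit i p) v i.
  move=> pA; apply: lt_le_trans (hKf p pA) _.
  rewrite (big_ord_widen_cond K (fun i => hit i p) v) ?leq_bigmax//.
  rewrite big_mkcond [leRHS]big_mkcond; apply: ler_sum => i _.
  by case: (hit i p) => //=; case: (i < Kf p)%N.
pose w i := Num.min 1 (v i / theta).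
have w0 i : 0 <= w i by rewrite /w le_min ler01 divr_ge0// ltW.
have hw p : p \in A -> 1 <= \sum_(i < K | hit i p) w i.
  move=> pA; have [/existsP[i /andP[hi vi]]|] :=
      boolP [exists i : 'I_K, hit i p && (theta <= v i)].
    rewrite (bigD1 i)//= (_ : w i = 1); last first.
      by rewrite /w min_l// ler_pdivlMr// mul1r.
    by rewrite lerDl sumr_ge0.
  rewrite negb_exists => /forallP hn.
  have -> : \sum_(i < K | hit i p) w i = \sum_(i < K | hit i p) v i / theta.
    apply: eq_bigr => i hi; have := hn i; rewrite hi /= -ltNge => lt.
    by rewrite /w min_r// ler_pdivrMr// mul1r ltW.
  by rewrite -mulr_suml ler_pdivlMr// mul1r ltW// hKf.
have := hlt K; rewrite ltNge => /negP; apply.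
apply: (@le_trans _ _ (\sum_(p in A) \sum_(i < K | hit i p) w i)).
  by rewrite -sum1_card natr_sum; apply: ler_sum => p pA; exact: hw.
rewrite (exchange_big_dep (fun _ => true))//=; apply: ler_sum => i _.
rewrite -[in leRHS]sum1_card natr_sum mulr_sumr.
rewrite le_eqVlt; apply/orP; left; apply/eqP.
by apply: eq_big => [p|p _]; [rewrite inE|rewrite mulr1].
Qed.

End Selection.

Section Children.
Context {R : realType}.
Variables (U : nat -> set R) (r : nat -> R).
Hypothesis r_gt0 : forall i, 0 < r i.
Hypothesis U_diam : forall i x y, U i x -> U i y -> `|x - y| <= r i.

Definition touches i (c rho : R) : bool := `[< exists2 x, U i x & `|x - c| <= rho >].

(** The induction hypothesis of the construction: the sets that meet the interval
    of centre c and radius rho have small total s-cost, uniformly over finite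
    subfamilies.  For kap < 1 each r_i among them is less than rho. *)
Definition light (kap s c rho : R) :=
  forall K, \sum_(i < K | touches i c rho) r i `^ s <= kap * rho `^ s.

Lemma touches_sub i (c rho c' rho' : R) : `|c' - c| + rho' <= rho ->
  touches i c' rho' -> touches i c rho.
Proof.
move=> h /asboolP[x Ux hx]; apply/asboolP; exists x => //.
rewrite (_ : x - c = (x - c') + (c' - c)); last by ring.
by rewrite (le_trans (ler_normD _ _))//; lra.
Qed.

Lemma touches_dist i (c c' rho : R) : touches i c rho -> touches i c' rho ->
  `|c - c'| <= r i + 2 * rho.
Proof.
move=> /asboolP[x Ux hx] /asboolP[y Uy hy]; have hxy := U_diam Ux Uy.
rewrite (_ : c - c' = (x - y) + ((y - c') - (x - c))); last by ring.
rewrite (le_trans (ler_normD _ _))//.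
have := ler_normB (y - c') (x - c); lra.
Qed.

Section Hits.
Variables (n L : nat) (c rho rho' : R) (i : nat).
Hypotheses (Ln : (2 * L < n)%N) (rho'0 : 0 <= rho').

Let A := [set p in @farey R n L c rho | touches i (pair_frac p) rho'].

Let hitsP p : p \in A -> p \in @farey R n L c rho /\ touches i (pair_frac p) rho'.
Proof. by rewrite inE => /andP[]. Qed.

(** The packing bound for sets shorter than 1/n: the fractions are 1/n^2-separated. *)
Lemma card_hits_le_short : #|A|%:R <= (r i + 2 * rho') * n%:R ^+ 2 + 1.
Proof.
have r0 := r_gt0 i; have r'0 := rho'0.
have n0 : 0 < n%:R :> R by rewrite ltr0n; apply: leq_ltn_trans Ln.
rewrite -[n%:R ^+ 2]invrK; apply: (card_separated_le (g := @pair_frac R n L)).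
- by rewrite invr_gt0 exprn_gt0.
- lra.
- by move=> p p' /hitsP[_ h] /hitsP[_ h']; exact: touches_dist.
- by move=> p p' /hitsP[h _] /hitsP[h' _]; exact: (farey_separated Ln h h').
Qed.

(** For longer sets, counting numerators for each of the L denominators is more
    efficient than the separation of the fractions, as it uses that there are
    only about L n fractions per unit length. *)
Lemma card_hits_le_long : #|A|%:R <= L%:R * ((r i + 2 * rho') * n%:R + 1).
Proof.
have r0 := r_gt0 i; have r'0 := rho'0.
have -> : #|A| = (\sum_(l < L) #|[set b : 'I_n | (l, b) \in A]|)%N.
  rewrite -sum1_card.
  under [RHS]eq_bigr => l _ do rewrite -sum1_card.
  rewrite pair_big_dep /=; apply: eq_bigl => -[l b].
  by rewrite [in RHS]inE.
rewrite natr_sum; apply: sum_ord_le_const => l.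
have q0 : 0 < (den n l)%:R :> R by rewrite ltr0n (den_gt0 Ln).
apply: (@le_trans _ _ ((r i + 2 * rho') * (den n l)%:R + 1)); last first.
  by rewrite lerD2r ler_wpM2l ?ler_nat ?den_le//; lra.
rewrite -[(den n l)%:R]invrK.
apply: (card_separated_le (g := fun b : 'I_n => pair_frac (l, b))).
- by rewrite invr_gt0.
- lra.
- move=> b b'; rewrite inE => /hitsP[_ h]; rewrite inE => /hitsP[_ h'].
  exact: touches_dist.
- move=> b b' _ _ bb'; rewrite /pair_frac /= -mulrBl normrM [X in _ * X]gtr0_norm ?invr_gt0//.
  rewrite ler_peMl ?invr_ge0 ?(ltW q0)//.
  have -> : b%:R - b'%:R = (b%:Z - b'%:Z)%:~R :> R by rewrite rmorphB.
  rewrite -intr_norm -[1]/(1%:~R) ler_int -gtz0_ge1 normr_gt0 subr_eq0.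
  by apply: contra bb' => /eqP[] /val_inj ->.
Qed.

End Hits.
End Children.

Lemma exists_large_odd a b c d : exists n : nat,
  [/\ odd n, (a <= n)%N, (b <= n)%N, (c <= n)%N & (2 * d < n /\ 2 < n)%N].
Proof.
exists (2 * (a + b + c + d).+1).+1; split; try split; lia.
Qed.

(** The comparison of orders of magnitude behind the choice of a child: Y stands
    for n^(1 - e), P for rho^s, A for n^(1 + s) and B for n^(tau s). *)
Lemma count_dominates (R : realType) (X Y L rho P A B : R) :
  0 <= P <= 1 -> 0 < rho <= 1 / 2 -> 1 <= L -> L <= Y -> Y <= 2 * L ->
  100 * Y <= X * rho -> A <= Y * Y -> B <= Y * Y -> 0 <= A -> 0 <= B ->
  1 / 12 * P * A + 2 * P * B + L * X * rho / 4 <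
  L * ((X - 2 * L) * rho - 1) - 9 * L ^+ 2.
Proof.
move=> /andP[P0 P1] /andP[rho0 rhoh] L1 LY YL YrX AY BY A0 B0.
have L0 : 0 <= L by lra.
have Y0 : 0 <= Y by lra.
have YY : Y * Y <= 2 * L * (X * rho / 100).
  by apply: ler_pM => //; lra.
have LL : L * L <= L * (X * rho / 100) by apply: ler_wpM2l; lra.
have t1 : P * A <= Y * Y by rewrite -[leRHS]mul1r; apply: ler_pM.
have t2 : P * B <= Y * Y by rewrite -[leRHS]mul1r; apply: ler_pM.
have t3 : L * L * rho <= L * L * (1 / 2).
  by apply: ler_wpM2l => //; exact: mulr_ge0.
have t4 : L <= L * L by rewrite ler_peMr.
move: t1 t2 t3 t4 YY LL; rewrite expr2; lra.
Qed.

Section Step.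
Context {R : realType}.
Variables (U : nat -> set R) (r : nat -> R) (s tau : R).
Hypothesis r_gt0 : forall i, 0 < r i.
Hypothesis U_diam : forall i x y, U i x -> U i y -> `|x - y| <= r i.

Local Notation light := (light U r (1 / 12) s).

Lemma touches_radius_le i (c rho : R) : 0 < s -> 0 < rho -> light c rho ->
  touches U i c rho -> r i <= rho.
Proof.
move=> s0 rho0 lt mi; have := lt i.+1; rewrite big_mkcond big_ord_recr /= mi.
have sum0 : 0 <= \sum_(j < i) (if touches U j c rho then r j `^ s else 0).
  by apply: sumr_ge0 => j _; case: ifP => // _; exact: powR_ge0.
have rs0 : 0 < rho `^ s by apply: powR_gt0.
move=> h; have {sum0} h : r i `^ s < rho `^ s by lra.
rewrite leNgt; apply: contraTN h => h.
by rewrite -leNgt ge0_ler_powR ?nnegrE ?(ltW s0) ?(ltW rho0) ?(ltW (r_gt0 i)) ?(ltW h).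
Qed.

(** The weight of the i-th set times the number of fractions near it, as a multiple
    of r_i^s.  For r_i <= 1/n the short count is used: its main part r_i n^2 goes
    with weight 1, its bounded part with weight r_i^s / theta.  For r_i > 1/n the
    long count gives 3 L n r_i. *)
Lemma weighted_hits_le (n L : nat) (c rho rho' : R) i :
  (0 < L)%N -> (2 * L < n)%N ->
  0 < s < 1 -> 0 < rho' -> 0 < rho -> r i <= rho -> 2 * rho' * n%:R ^+ 2 <= 1 ->
  Num.min 1 (r i `^ s / (1 / 12 * rho' `^ s)) *
    #|[set p in @farey R n L c rho | touches U i (pair_frac p) rho']|%:R <=
  r i `^ s * (n%:R `^ (1 + s) + 24 / rho' `^ s + 3 * L%:R * n%:R * rho `^ (1 - s)).
Proof.
move=> L0 Ln /andP[s0 s1] rho'0 rho0 rrho hrho'.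
have r0 := r_gt0 i.
have n0 : 0 < n%:R :> R by rewrite ltr0n; apply: leq_ltn_trans Ln.
have n1 : 1 <= n%:R :> R by rewrite ler1n -(ltr0n R).
have hs := @card_hits_le_short R U r r_gt0 U_diam n L c rho rho' i Ln (ltW rho'0).
have hl := @card_hits_le_long R U r r_gt0 U_diam n L c rho rho' i Ln (ltW rho'0).
set h := #|_|%:R in hs hl *.
have h0 : 0 <= h by rewrite ler0n.
set v := r i `^ s; have v0 : 0 < v by apply: powR_gt0.
set t := rho' `^ s; have t0 : 0 < t by apply: powR_gt0.
have -> : v / (1 / 12 * t) = 12 * v / t by field; rewrite gt_eqF.
set w := Num.min _ _.
have w1 : w <= 1 by rewrite ge_min lexx.
have w2 : w <= 12 * v / t by rewrite ge_min lexx orbT.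
have q0 : 0 < v / t by rewrite divr_gt0.
have w0 : 0 <= w by rewrite le_min ler01 -mulrA mulr_ge0 ?(ltW q0).
have rE : r i = v * r i `^ (1 - s).
  by rewrite /v -powRD; [rewrite addrC subrK powRr1// ltW|apply/implyP => _; rewrite gt_eqF].
have T1 : 0 <= n%:R `^ (1 + s) by apply: powR_ge0.
have T3 : 0 <= 3 * L%:R * n%:R * rho `^ (1 - s) by rewrite !mulr_ge0 ?powR_ge0 ?(ltW n0).
have [rn|rn] := leP (r i * n%:R) 1.
  have hr : r i * n%:R ^+ 2 <= v * n%:R `^ (1 + s).
    rewrite {1}rE -mulrA; apply: ler_wpM2l; first exact: ltW.
    have -> : n%:R ^+ 2 = n%:R `^ (1 - s) * n%:R `^ (1 + s) :> R.
      rewrite -powRD; last by apply/implyP => _; rewrite gt_eqF.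
      by rewrite (_ : 1 - s + (1 + s) = 2%:R) ?powR_mulrn ?(ltW n0)//; ring.
    rewrite mulrA -powRM ?(ltW r0) ?(ltW n0)// ler_piMl//.
    rewrite -[leRHS](_ : 1 `^ (1 - s) = 1); last by rewrite powR1.
    by apply: ge0_ler_powR; rewrite ?nnegrE ?subr_ge0 ?(ltW s1) ?mulr_ge0 ?(ltW r0) ?(ltW n0).
  have h2 : h <= r i * n%:R ^+ 2 + 2 by lra.
  have hw1 : w * (r i * n%:R ^+ 2) <= v * n%:R `^ (1 + s).
    apply: le_trans hr; rewrite ler_piMl// mulr_ge0 ?(ltW r0)// exprn_ge0// ltW.
  have hw2 : w * 2 <= v * (24 / t).
    have -> : v * (24 / t) = 12 * v / t * 2 by field; rewrite gt_eqF.
    by rewrite ler_pM2r.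
  have hw3 : w * h <= w * (r i * n%:R ^+ 2 + 2) by apply: ler_wpM2l.
  have := mulr_ge0 (ltW v0) T3; lra.
have hn : (r i + 2 * rho') * n%:R + 1 <= 3 * (r i * n%:R).
  have : 2 * rho' * n%:R <= 1.
    apply: le_trans hrho'; rewrite expr2 mulrA ler_peMr// !mulr_ge0 ?(ltW n0) ?(ltW rho'0)//.
  lra.
have hh : h <= v * (3 * L%:R * n%:R * rho `^ (1 - s)).
  apply: (le_trans hl); apply: (@le_trans _ _ (L%:R * (3 * (r i * n%:R)))).
    by apply: ler_wpM2l.
  have -> : L%:R * (3 * (r i * n%:R)) = v * (3 * L%:R * n%:R * r i `^ (1 - s)).
    by rewrite {1}rE; ring.
  apply: ler_wpM2l; first exact: ltW.
  apply: ler_wpM2l; first by rewrite !mulr_ge0 ?(ltW n0).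
  by apply: ge0_ler_powR; rewrite ?nnegrE ?subr_ge0 ?(ltW s1) ?(ltW r0) ?(ltW rho0).
have : w * h <= h by rewrite ler_piMl.
have := mulr_ge0 (ltW v0) T1.
have : 0 <= v * (24 / t) by rewrite mulr_ge0 ?(ltW v0)// divr_ge0 ?(ltW t0).
lra.
Qed.

(** The candidates are the fractions of the window of length about n^(1 - e) below
    n, thickened to rho' = n^-tau.  Both n^(1 + s) and rho'^-s = n^(tau s) are at
    most n^(2 - 2e), negligible against the number of candidates, of order
    L n rho; the third term of the weighted count is a quarter of L n rho thanks
    to the constant 1/12. *)
Lemma light_child_exists (c rho : R) (M : nat) :
  0 < s < 1 -> 2 < tau -> tau * s < 2 ->
  0 < rho <= 1 / 2 -> 0 <= c - rho -> c + rho <= 1 -> light c rho ->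
  exists (q b : nat) (rho' : R), [/\ (M <= q)%N && odd q, 0 < rho' <= q%:R `^ (- tau),
    rho' <= rho / 2, `|b%:R / q%:R - c| + rho' <= rho & light (b%:R / q%:R) rho'].
Proof.
move=> /andP[s0 s1] tau2 taus /andP[rho0 rhoh] c0 c1 lt.
pose e := Num.min (1 - s) (2 - tau * s) / 2.
have m1 : Num.min (1 - s) (2 - tau * s) <= 1 - s by rewrite ge_min lexx.
have m2 : Num.min (1 - s) (2 - tau * s) <= 2 - tau * s by rewrite ge_min lexx orbT.
have m0 : 0 < Num.min (1 - s) (2 - tau * s) by rewrite lt_min; apply/andP; split; lra.
have e0 : 0 < e by rewrite /e; lra.
have e1 : 2 * e <= 1 - s by rewrite /e; lra.
have e2 : 2 * e <= 2 - tau * s by rewrite /e; lra.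
have [N1 h1] := @powR_nat_large R (100 / rho) e e0.
have [N2 h2] := @powR_nat_large R 2 (tau - 2) ltac:(lra).
have [N3 h3] := @powR_nat_large R (2 / rho) tau ltac:(lra).
have [n [n_odd /h1{}h1 /h2{}h2 /h3{}h3 [nM n2]]] := exists_large_odd N1 N2 N3 M.
set X : R := n%:R in h1 h2 h3.
have X0 : 0 < X by rewrite ltr0n (leq_trans _ n2).
have X1 : 1 <= X by rewrite ler1n (leq_trans _ n2).
have XD a b : X `^ (a + b) = X `^ a * X `^ b.
  by rewrite powRD//; apply/implyP => _; rewrite gt_eqF.
pose Y := X `^ (1 - e).
have Y1 : 1 <= Y by rewrite -[leLHS](powRr0 X) ler_powR//; lra.
have YX : Y * X `^ e = X by rewrite -XD subrK powRr1// ltW.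
have YrX : 100 * Y <= X * rho.
  have := ler_wpM2l (ltW (lt_le_trans ltr01 Y1)) h1.
  by rewrite YX mulrA ler_pdivrMr//; lra.
pose L := Num.truncn Y.
have LY : L%:R <= Y by rewrite truncn_le; lra.
have L0 : (0 < L)%N by rewrite truncn_gt0.
have L1 : 1 <= L%:R :> R by rewrite ler1n.
have YL : Y <= 2 * L%:R.
  by have := truncnS_gt Y; rewrite -/L -[L.+1%:R]natr1; lra.
have LX : 2 * L%:R <= X / 2 by nra.
have Ln : (2 * L < n)%N by rewrite -(ltr_nat R) natrM -/X; lra.
pose rho' := X `^ (- tau).
have r'0 : 0 < rho' by apply: powR_gt0.
have r'rho : rho' <= rho / 2.
  rewrite /rho' powRN -[rho / 2]invrK lef_pV2 ?posrE ?powR_gt0// ?invr_gt0 ?divr_gt0//.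
  by rewrite invf_div.
have r'X : 2 * rho' * X ^+ 2 <= 1.
  have -> : X ^+ 2 = X `^ 2%:R by rewrite powR_mulrn// ltW.
  rewrite -mulrA -XD (_ : - tau + 2%:R = - (tau - 2)); last by ring.
  by rewrite powRN ler_pdivrMr ?powR_gt0// mul1r.
have rho'E : rho' `^ s = (X `^ (tau * s))^-1.
  by rewrite /rho' -powRrM mulNr powRN.
have th0 : 0 < 1 / 12 * rho' `^ s by rewrite mulr_gt0 ?powR_gt0//; lra.
have [|K|p pF hp] := @exists_light_point R _ (@farey R n L c rho)
   (fun i p => touches U i (pair_frac p) rho') (fun i => r i `^ s) _ th0.
- by move=> i; exact: powR_ge0.
- pose B := X `^ (1 + s) + 24 / rho' `^ s + 3 * L%:R * X * rho `^ (1 - s).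
  have B0 : 0 <= B.
    by rewrite !addr_ge0 ?powR_ge0 ?divr_ge0 ?powR_ge0// !mulr_ge0 ?powR_ge0 ?(ltW X0).
  apply: (@le_lt_trans _ _ (\sum_(i < K | touches U i c rho) r i `^ s * B)).
    rewrite [leRHS]big_mkcond /=; apply: ler_sum => i _.
    have [mi|nmi] := boolP (touches U i c rho).
      apply: weighted_hits_le => //; first by rewrite s0.
      exact: touches_radius_le mi.
    rewrite (_ : #|_| = 0%N) ?mulr0//; apply: eq_card0 => p.
    apply/negbTE/negP; rewrite inE => /andP[pF tp].
    case/negP: nmi; apply: touches_sub tp.
    by move: pF; rewrite !inE => /andP[hp _]; lra.
  rewrite -mulr_suml; apply: le_lt_trans (ler_wpM2r B0 (lt K)) _.
  have FG := card_farey_ge Ln rho0 c0 c1 n_odd L0.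
  apply: lt_le_trans FG.
  have -> : (n - 2 * L)%:R = X - 2 * L%:R :> R by rewrite natrB ?natrM// ltnW.
  have rs : rho `^ s * rho `^ (1 - s) = rho.
    by rewrite -powRD; [rewrite addrC subrK powRr1// ltW|apply/implyP => _; rewrite gt_eqF].
  have rs1 : rho `^ s <= 1.
    rewrite -[leRHS](_ : 1 `^ s = 1); last by rewrite powR1.
    by apply: ge0_ler_powR; rewrite ?nnegrE; lra.
  have rs0 : 0 <= rho `^ s by apply: powR_ge0.
  have BE : 1 / 12 * rho `^ s * B = 1 / 12 * rho `^ s * X `^ (1 + s) +
     2 * rho `^ s * X `^ (tau * s) + L%:R * X * rho / 4.
    have LXE : L%:R * X * rho = L%:R * X * (rho `^ s * rho `^ (1 - s)) by rewrite rs.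
    by rewrite /B rho'E invrK LXE; field.
  rewrite {}BE.
  have XY : Y * Y = X `^ (2 - 2 * e) by rewrite -XD; congr (_ `^ _); ring.
  have X1s : X `^ (1 + s) <= Y * Y by rewrite XY ler_powR//; lra.
  have X2s : X `^ (tau * s) <= Y * Y by rewrite XY ler_powR//; lra.
  apply: (count_dominates _ _ L1 LY YL YrX X1s X2s (powR_ge0 _ _) (powR_ge0 _ _)).
    by rewrite rs0.
  by rewrite rho0.
exists (den n p.1), p.2, rho'; move: pF; rewrite !inE => /andP[hpc _].
have Q0 : (0 < den n p.1)%N by exact: den_gt0.
have QR : 0 < (den n p.1)%:R :> R by rewrite ltr0n.
split => //.
- rewrite den_odd// andbT -(ler_nat R); apply: (@le_trans _ _ (X - 2 * L%:R)).
    by have : (2 * M)%:R <= X by [rewrite ler_nat ltnW]; rewrite natrM; lra.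
  rewrite natrB; last exact/ltnW/lt_double.
  rewrite natrM lerD2l lerN2 ler_pM2l// ler_nat; exact/ltnW/ltn_ord.
- rewrite r'0 /rho' !powRN lef_pV2 ?posrE ?powR_gt0//.
  apply: ge0_ler_powR; rewrite ?nnegrE ?(ltW QR) ?(ltW X0)//; first lra.
  by rewrite ler_nat den_le.
- by move: hpc; rewrite /pair_frac; lra.
Qed.

End Step.

(** * The lower bound *)

Section LowerBound.
Local Open Scope classical_set_scope.
Context {R : realType}.
Implicit Types (alpha s tau : R).

Lemma nested_intervals_point (c rho : nat -> R) :
  (forall k, 0 <= rho k) -> (forall k, `|c k.+1 - c k| + rho k.+1 <= rho k) ->
  exists x, forall k, `|x - c k| <= rho k.
Proof.
move=> rho0 nest.
have nestD k j : `|c (k + j)%N - c k| + rho (k + j)%N <= rho k.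
  elim: j => [|j IH]; first by rewrite addn0 subrr normr0 add0r.
  rewrite addnS; have h := nest (k + j)%N.
  have := ler_normD (c (k + j).+1 - c (k + j)%N) (c (k + j)%N - c k).
  by rewrite addrA subrK; lra.
have lr i k : c i - rho i <= c k + rho k.
  have [ik|ki] := leqP i k.
    have := nestD i (k - i)%N; rewrite subnKC// => h.
    have := rho0 k; have := ler_norm (c i - c k); rewrite distrC; lra.
  have := nestD k (i - k)%N; rewrite subnKC ?(ltnW ki)// => h.
  have := rho0 i; have := ler_norm (c i - c k); lra.
pose A := range (fun k => c k - rho k).
have A0 : A !=set0 by exists (c 0%N - rho 0%N); exists 0%N.
have Aub k : ubound A (c k + rho k) by move=> _ [i _ <-].
exists (sup A) => k; rewrite ler_distl; apply/andP; split.
  by apply: ub_le_sup; [exists (c 0%N + rho 0%N)|exists k].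
exact: ge_sup.
Qed.

Section Avoidance.
Variables (U : nat -> set R) (r : nat -> R) (s tau : R).
Hypothesis r_gt0 : forall i, 0 < r i.
Hypothesis U_diam : forall i x y, U i x -> U i y -> `|x - y| <= r i.

(** Iterating the choice of a child interval; the k-th child has a centre with
    denominator at least k. *)
Lemma exists_uncovered_approximable :
  0 < s < 1 -> 2 < tau -> tau * s < 2 ->
  (forall K, \sum_(i < K) r i `^ s <= 1 / 12 * (1 / 2) `^ s) ->
  exists x, [/\ 0 <= x <= 1, forall i, ~ U i x &
    forall M : nat, exists q b : nat, [/\ (M <= q)%N, odd q &
      `|x - b%:R / q%:R| <= q%:R `^ (- tau)]].
Proof.
move=> s01 tau2 taus rsum.
pose inv (p : R * R) := [/\ 0 < p.2 <= 1 / 2, 0 <= p.1 - p.2, p.1 + p.2 <= 1 &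
   light U r (1 / 12) s p.1 p.2].
pose next (M : nat) (p p' : R * R) := [/\ inv p', p'.2 <= p.2 / 2,
   `|p'.1 - p.1| + p'.2 <= p.2 & exists q b : nat, [/\ (M <= q)%N, odd q,
     p'.1 = b%:R / q%:R & p'.2 <= q%:R `^ (- tau)]].
have step (a : nat * (R * R)) : exists p', inv a.2 -> next a.1 a.2 p'.
  have [ia|nia] := pselect (inv a.2); last by exists a.2.
  have [h1 h2 h3 h4] := ia.
  have [q [b [rho' [/andP[Mq oq] /andP[r0 rq] rh hn hl]]]] :=
    light_child_exists r_gt0 U_diam a.1 s01 tau2 taus h1 h2 h3 h4.
  exists (b%:R / q%:R, rho') => _; split => //=; last by exists q, b.
  have := ler_norm (b%:R / q%:R - a.2.1).
  have := ler_norm (- (b%:R / q%:R - a.2.1)); rewrite normrN => n1 n2.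
  case/andP: h1 => h10 h11.
  split => //=; first (by apply/andP; split => //; lra); lra.
have [f hf] := choice step.
pose u := fix u k : R * R := if k is k'.+1 then f (k', u k') else (1 / 2, 1 / 2).
have u0 : inv (u 0%N).
  split => /=; try lra.
  move=> K; apply: le_trans (rsum K); rewrite big_mkcond; apply: ler_sum => i _.
  by case: ifP => // _; exact: powR_ge0.
have uinv k : inv (u k) by elim: k => // k IH; have [] := hf (k, u k) IH.
have unext k : next k (u k) (u k.+1) by exact: (hf (k, u k) (uinv k)).
have rho0 k : 0 < (u k).2 by have [/andP[]] := uinv k.
have [x hx] : exists x, forall k, `|x - (u k).1| <= (u k).2.
  apply: nested_intervals_point => k; first exact: ltW.
  by have [] := unext k.
exists x; split.
- have := hx 0%N; rewrite /= ler_norml => /andP[? ?]; apply/andP; split; lra.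
- move=> i Uix.
  have small k : (u k).2 <= 2^-1 ^+ k.
    elim: k => [|k IH]; first by rewrite expr0 /=; lra.
    by have [_ h _ _] := unext k; rewrite exprS; lra.
  have ri k : r i <= (u k).2.
    have [_ _ _ lk] := uinv k.
    apply: (touches_radius_le r_gt0 _ (rho0 k) lk); first by case/andP: s01.
    by apply/asboolP; exists x.
  have /cvgrPdist_lt/(_ (r i) (r_gt0 i))[k _ hk] :
      (fun k => 2^-1 ^+ k : R) @ \oo --> (0 : R).
    by apply: cvg_expr; rewrite ger0_norm; lra.
  have := hk k (leqnn k); rewrite /= sub0r normrN ger0_norm ?exprn_ge0//.
  by have := ri k; have := small k; lra.
- move=> M; have [_ _ _ [q [b [Mq oq e le]]]] := unext M.
  by exists q, b; split => //; rewrite -e; apply: le_trans (hx M.+1) le.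
Qed.

End Avoidance.

(** The radii are inflated by a geometric series so as to be positive even for
    sets reduced to a point. *)
Lemma hausdorff_measure_eq0_cover (V : normedModType R) s (S : set V) (e : R) :
  0 < s -> 0 < e -> hausdorff_measure s S = 0%E ->
  exists (F : nat -> set V) (r : nat -> R), [/\ S `<=` \bigcup_k F k,
    forall k, 0 < r k, forall k x y, F k x -> F k y -> `|x - y| <= r k &
    forall K, \sum_(k < K) r k `^ s <= e].
Proof.
move=> s0 e0 mS.
have e2 : 0 < e / 2 by lra.
have : (hausdorff_premeasure s 1 S < (e / 2)%:E)%E.
  apply: (@le_lt_trans _ _ (hausdorff_measure s S)).
    by apply: ereal_sup_ubound; exists 1 => //=.
  by rewrite mS lte_fin.
move=> /ereal_inf_lt[_ [F [SF Fd] <-] Fe].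
have Ffin k : exists g : R, hausdorff_gauge s (F k) = g%:E /\ 0 <= g.
  have le := hausdorff_gauge_le (ltW s0) (Fd k).
  have ge := hausdorff_gauge_ge0 s (F k).
  by move: le ge; case: (hausdorff_gauge _ _) => // g _ ?; exists g.
have [g hg] := choice Ffin.
pose v k := g k + e / 2 * 2^-1 ^+ k.+1.
have v0 k : 0 < v k by rewrite ltr_wpDl ?(hg k).2// mulr_gt0// exprn_gt0// invr_gt0.
exists F, (fun k => v k `^ s^-1); split => //.
- by move=> k; apply: powR_gt0.
- move=> k x y Fx Fy.
  have [d dE] : exists d, diameter (F k) = d%:E.
    have := diameter_ge0 (F k); have := Fd k.
    by case: (diameter _) => // d _ _; exists d.
  have xyd : `|x - y| <= d by apply: (dist_le_diameter _ Fx Fy); rewrite dE.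
  have d0 : 0 <= d by apply: le_trans xyd.
  have gd : g k = d `^ s.
    apply: EFin_inj; rewrite -(hg k).1 /hausdorff_gauge dE poweR_EFin.
    by case: ifP => // /eqP F0; move: Fx; rewrite F0.
  apply: (le_trans xyd).
  have -> : d = (d `^ s) `^ s^-1 by rewrite -powRrM divff ?gt_eqF// powRr1.
  apply: ge0_ler_powR; rewrite ?nnegrE ?invr_ge0 ?powR_ge0 ?(ltW s0) ?(ltW (v0 k))//.
  by rewrite /v gd lerDl mulr_ge0 ?(ltW e2)// exprn_ge0// invr_ge0.
- move=> K.
  under eq_bigr => k _ do rewrite -powRrM mulVf ?gt_eqF// powRr1 ?(ltW (v0 k))//.
  rewrite big_split /=.
  have h1 : \sum_(k < K) g k <= e / 2.
    rewrite -lee_fin -sumEFin; apply: le_trans (ltW Fe).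
    under eq_bigr => k _ do rewrite -(hg k).1.
    rewrite -(big_mkord xpredT (fun k => hausdorff_gauge s (F k))).
    by apply: nneseries_lim_ge => k *; exact: hausdorff_gauge_ge0.
  have h2 : \sum_(k < K) 2^-1 ^+ k.+1 = 1 - 2^-1 ^+ K :> R.
    elim: K {h1} => [|K IH]; first by rewrite big_ord0 expr0 subrr.
    by rewrite big_ord_recr /= IH exprS; field.
  rewrite -mulr_sumr h2.
  have : 0 <= 2^-1 ^+ K :> R by rewrite exprn_ge0// invr_ge0.
  by move: (2^-1 ^+ K) => t t0; nra.
Qed.

Lemma hausdorff_dim_large_weyl_set_ge alpha :
  3 / 4 <= alpha -> alpha <= 1 ->
  ((4 * (1 - alpha))%:E <= hausdorff_dim (large_weyl_set alpha))%E.
Proof.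
move=> alo ahi; apply: le_ereal_inf_tmp => _ [s [s0 ms] <-].
rewrite lee_fin leNgt; apply/negP => slt.
have a1 : alpha < 1 by lra.
pose tau := ((2 * (1 - alpha))^-1 + 2 / s) / 2.
have b0 : 0 < 2 * (1 - alpha) by lra.
have lt : (2 * (1 - alpha))^-1 < 2 / s.
  by rewrite ltr_pdivlMr// mulrC ltr_pdivrMr//; lra.
have t1 : (2 * (1 - alpha))^-1 < tau by rewrite /tau; lra.
have t2 : tau < 2 / s by rewrite /tau; lra.
have i2 : 2 <= (2 * (1 - alpha))^-1.
  by rewrite -[2 in leLHS]invrK lef_pV2 ?posrE ?invr_gt0//; lra.
(* tau is the midpoint of the interval of exponents admissible for both halves. *)
have tau2 : 2 < tau by lra.
have taus : tau * s < 2 by rewrite -ltr_pdivlMr.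
have tala : 1 < 2 * tau * (1 - alpha).
  by move: t1; rewrite -[X in X < _]mul1r ltr_pdivrMr//; lra.
have k0 : 0 < 1 / 12 * (1 / 2) `^ s :> R by rewrite mulr_gt0 ?powR_gt0//; lra.
have [F [r [SF r0 Fr rsum]]] := hausdorff_measure_eq0_cover s0 k0 ms.
have s01 : 0 < s < 1 by apply/andP; split; lra.
have [x [x01 xU xq]] := exists_uncovered_approximable r0 Fr s01 tau2 taus rsum.
have : large_weyl_set alpha x.
  by apply: (large_weyl_set_of_approximable (tau := tau)) => //; lra.
by move=> /SF[i _ /xU].
Qed.

End LowerBound.

Theorem proposition1p1 (R : realType) (alpha : R) :
  3 / 4 <= alpha -> alpha <= 1 ->
  hausdorff_dim (large_weyl_set alpha) = (4 * (1 - alpha))%:E.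
Proof.
move=> alo ahi; apply/eqP; rewrite eq_le.
by rewrite hausdorff_dim_large_weyl_set_le// hausdorff_dim_large_weyl_set_ge.
Qed.
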